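(* Let $a,b,c,v,\xi$ be real constants with $a>0$, $v>0$, $\xi>0$. The fundamental solution $u(t,x;\xi)$ of $$u_t=(a t^{2v-1}xu)_{xx}-((bx+c)u)_x,\qquad 0<x<\infty,$$ with flux $f(t)$ at the origin, has Laplace transform in $x$ (corresponding to $\pi(s)=e^{-s\xi}$) $$\omega(t,s;\xi)=e^{-G(t;K(t,s))+G^{\star}(0;K(t,s))}\,\exp\!\left(-\frac{s e^{bt}\,\xi}{1-s e^{bt}\,a b^{-2v}\,(\Gamma(2v,bt)-\Gamma(2v))}\right)+e^{-G(t;K(t,s))}\int_0^t f(\tau)\,e^{G(\tau;K(t,s))}\,d\tau ,$$ where $$K(t,s)=\frac{1-s\,a b^{-2v}\,\Gamma(2v,bt)\,e^{bt}}{s e^{bt}},$$ and $u(t,x;\xi)=\mathfrak L^{-1}\{\omega(t,s;\xi)\}$, where $\mathfrak L^{-1}$ denotes the inverse Laplace transform from $s$ to $x$.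
   Context: A function $u(t,x)$ is a solution of the equation if, for $x>0$, it has continuous partial derivatives satisfying the equation, and if for every fixed $s>0$ and $t>0$ the functions $e^{-sx}u(t,x)$ and $e^{-sx}u_t(t,x)$ are integrable over $0<x<\infty$, uniformly in every interval $0<t_0\le t\le t_1<\infty$. Its Laplace transform is $\omega(t,s)=\int_0^\infty e^{-sx}u(t,x)\,dx$. The flux of $u$ at the origin is $f(t)=-\lim_{x\to0}\{(a t^{2v-1}x u)_x-(bx+c)u\}$. A solution has initial values $P(x)$ if $\lim_{t\to0}\int_0^x u(t,y)\,dy=P(x)$ at every point of continuity of $P$. Here $P$ is of bounded variation on $(0,\infty)$, $P(x)\to0$ as $x\to0$, and $\pi(s)=\int_0^\infty e^{-sx}\,dP(x)$ exists. A fundamental solution with parameter $\xi>0$ is a solution with initial values $0$ for $x<\xi$ and $1$ for $x>\xi$, i.e. $\omega(t,s;\xi)\to e^{-s\xi}$ as $t\to0$. $\Gamma(q,p)=\int_p^\infty x^{q-1}e^{-x}\,dx$ is the upper incomplete gamma function and $\Gamma(q)=\Gamma(q,0)$. For a parameter $\mathcal C$, $G(\mu;\mathcal C)$ denotes the indefinite integral with respect to $\mu$, with the constant of integration omitted, of $$\mu\mapsto\frac{c}{a b^{-2v}\,\Gamma(2v,b\mu)\,e^{b\mu}+e^{b\mu}\,\mathcal C},$$ and $G^{\star}(\nu;\mathcal C)$ is the value of the same antiderivative at $\mu=\nu$; the formula involves only differences of values of this antiderivative. In $G(\tau;K(t,s))$ the parameter $K(t,s)$ is held fixed while $\tau$ varies.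 The quantities $b^{-2v}\Gamma(2v,\cdot)$ enter only through differences, and for $b\le 0$ these are read via $b^{-2v}(\Gamma(2v,b\mu)-\Gamma(2v,bt))=\int_\mu^t r^{2v-1}e^{-br}\,dr$. *)

(* Defs.v *)
From HB Require Import structures.
From mathcomp Require Import all_boot all_order all_algebra.
From mathcomp Require Import all_classical all_reals all_analysis.
Set Implicit Arguments.
Unset Strict Implicit.
Unset Printing Implicit Defensive.
Import Order.TTheory GRing.Theory Num.Theory.
Import numFieldNormedType.Exports.
Local Open Scope classical_set_scope.
Local Open Scope ring_scope.

(* A function u(t, x) on the open quadrant t > 0, x > 0 is represented by a   *)
(* total u : R -> R -> R, with the time variable first; its values outside    *)
(* the quadrant are never used.                                               *)

Section Laplace.
Context {R : realType}.
Implicit Types (h F : R -> R) (u w : R -> R -> R).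

Definition laplace_integrable h : Prop := forall s : R, 0 < s ->
  (@lebesgue_measure R).-integrable `]0, +oo[
    (EFin \o (fun x => expR (- (s * x)) * h x)).

Definition laplace h (s : R) : R :=
  \int[@lebesgue_measure R]_(x in `]0, +oo[) (expR (- (s * x)) * h x).

(* The integrability over (0, oo) is locally uniform in t: the mass of the    *)
(* integrand near 0 and near infinity is small uniformly in t0 <= t <= t1.    *)
Definition laplace_uniformly_integrable w : Prop :=
  (forall t : R, 0 < t -> laplace_integrable (w t)) /\
  forall s t0 t1 e : R, 0 < s -> 0 < t0 -> t0 <= t1 -> 0 < e ->
    exists d X : R, [/\ 0 < d, d < X &
      forall t : R, t0 <= t <= t1 ->
        (\int[@lebesgue_measure R]_(x in `]0%R, d] `|` `[X, +oo[)
           (`|expR (- (s * x)) * w t x|%:E) <= e%:E)%E].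

Definition is_original F h : Prop :=
  [/\ forall x : R, 0 < x -> {for x, continuous h},
      laplace_integrable h &
      forall s : R, 0 < s -> laplace h s = F s].

(* h = L^{-1}{F} on (0, oo): h is the one and only continuous function there  *)
(* whose Laplace transform is F.                                              *)
Definition is_inverse_laplace F h : Prop :=
  is_original F h /\
  forall k, is_original F k -> forall x : R, 0 < x -> k x = h x.

(* Integral over (0, t], improper at 0.                                       *)
Definition truncated_integral h (t e : R) : R :=
  \int[@lebesgue_measure R]_(r in `[e, t]) h r.

Definition improper_integral h (t : R) : R :=
  lim (truncated_integral h t e @[e --> 0^'+]).

End Laplace.

Section Equation.
Context {R : realType}.
Variables a b c v : R.
Implicit Types (u : R -> R -> R) (f P : R -> R).

Definition quadrant : set (R * R) := [set p | 0 < p.1 /\ 0 < p.2].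

Definition partial_t u (t x : R) : R := derive1 (fun r => u r x) t.

Definition diffusion_term u (t x : R) : R := a * t `^ (2 * v - 1) * x * u t x.

Definition drift_term u (t x : R) : R := (b * x + c) * u t x.

Definition is_solution u : Prop :=
  [/\ forall t x : R, 0 < t -> 0 < x ->
        [/\ derivable (fun r => u r x) t 1,
            derivable (u t) x 1 & derivable (derive1 (u t)) x 1],
      forall p, quadrant p ->
        [/\ {for p, continuous (fun q : R * R => partial_t u q.1 q.2)},
            {for p, continuous (fun q : R * R => derive1 (u q.1) q.2)} &
            {for p, continuous (fun q : R * R => derive1n 2 (u q.1) q.2)}],
      forall t x : R, 0 < t -> 0 < x ->
        partial_t u t x =
          derive1n 2 (diffusion_term u t) x - derive1 (drift_term u t) x,
      laplace_uniformly_integrable u &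
      laplace_uniformly_integrable (partial_t u)].

Definition is_flux u f : Prop := forall t : R, 0 < t ->
  - (derive1 (diffusion_term u t) x - drift_term u t x) @[x --> 0^'+] --> f t.

Definition has_initial_values u P : Prop :=
  forall x : R, 0 < x -> {for x, continuous P} ->
    \int[@lebesgue_measure R]_(y in `]0, x[) u t y @[t --> 0^'+] --> P x.

(* For u of varying sign the convergence of the integrals over (0, x) does    *)
(* not force that of the Laplace transforms (mass may escape to infinity as   *)
(* t -> 0); the fundamental solution is required to have both.                *)
Definition is_fundamental_solution (xi : R) u : Prop :=
  [/\ is_solution u,
      has_initial_values u (fun x => if x < xi then 0 else 1) &
      forall s : R, 0 < s ->
        laplace (u t) s @[t --> 0^'+] --> expR (- (s * xi))].

Definition upper_Gamma (q p : R) : R :=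
  \int[@lebesgue_measure R]_(x in `[p, +oo[) (x `^ (q - 1) * expR (- x)).

(* b^{-2v} Gamma(2v, b mu).  Only differences of its values matter; for       *)
(* b <= 0, where the expression itself is meaningless, it is normalized to    *)
(* vanish at mu = 0, with the same differences                                *)
(*   scaled_Gamma mu - scaled_Gamma t = \int_mu^t r^{2v-1} e^{-br} dr.        *)
Definition scaled_Gamma (mu : R) : R :=
  if 0 < b then b `^ (- (2 * v)) * upper_Gamma (2 * v) (b * mu)
  else - \int[@lebesgue_measure R]_(r in `[0, mu])
           (r `^ (2 * v - 1) * expR (- (b * r))).

Definition G_denominator (C mu : R) : R :=
  a * scaled_Gamma mu * expR (b * mu) + expR (b * mu) * C.

(* G mu C is, for each C, an indefinite integral in mu of                     *)
(* c / G_denominator C mu, on every interval [0, M] on which the denominator  *)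
(* has no zero; the constant of integration is arbitrary.                     *)
Definition is_indefinite_integral (G : R -> R -> R) : Prop :=
  forall C M : R, 0 < M ->
    (forall mu, 0 <= mu <= M -> G_denominator C mu != 0) ->
    {within `[0, M], continuous (fun mu => G mu C)} /\
    forall mu : R, 0 < mu < M ->
      is_derive mu 1 (fun r : R => G r C) (c / G_denominator C mu).

Definition K (t s : R) : R :=
  (1 - s * a * scaled_Gamma t * expR (b * t)) / (s * expR (b * t)).

Definition omega (xi : R) (G : R -> R -> R) f (t s : R) : R :=
  expR (- G t (K t s) + G 0 (K t s)) *
    expR (- (s * expR (b * t) * xi /
             (1 - s * expR (b * t) * a * (scaled_Gamma t - scaled_Gamma 0)))) +
  expR (- G t (K t s)) *
    improper_integral (fun tau => f tau * expR (G tau (K t s))) t.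

End Equation.

(* Main.v *)
Require Import Defs.
From mathcomp Require Import all_boot all_order all_algebra.
From mathcomp Require Import all_classical all_reals all_analysis.
From mathcomp Require Import measurable_realfun ring lra.
Import Order.TTheory GRing.Theory Num.Theory.
Import numFieldNormedType.Exports.
Local Open Scope classical_set_scope.
Local Open Scope ring_scope.

(** The Laplace transform [w(t, s)] of [u(t, .)] solves a first order equation.
    For a fixed time, [exp(-s x) (J + s y)] with [y = a t^(2v-1) x u] and
    [J = y_x - (b x + c) u] is a primitive in [x] of
    [exp(-s x) (u_t + (s (b x + c) - s^2 a t^(2v-1) x) u)]; it tends to [- f(t)]
    at the origin and to 0 at infinity ([flux_transform]), which means that
    [w_t + (a t^(2v-1) s^2 - b s) w_s = f - c s w].
    The characteristics of this equation are the curves [s = 1 / p(t)] where [p]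
    is [G_denominator] for a fixed parameter, and [K t s] is the parameter of
    the characteristic through [(t, s)].  As [G' = c / p = c s] there,
    [exp(G) w] has derivative [exp(G) f] along a characteristic.  This is proved
    in integrated form: with [W(t) = w(t, s(t))] and a C^1 weight [m],
    [m W] is a primitive of [m f + (m' - c s m) W] ([characteristic_identity]),
    by integrating the [t]-derivative of [m(t) exp(- s(t) x) u(t, x)] over a
    strip in both orders.  Letting the lower end of the time interval tend to 0
    gives the formula, and the inverse transform is unique because a continuous
    function whose Laplace transform vanishes is zero ([laplace_injective]).

    The limit at [t = 0] is the delicate point.  The initial condition gives
    [w(t, s) --> exp(- s xi)] for each fixed [s], while [s] varies along a
    characteristic, and this convergence need not be uniform in [s].  Compare the
    given characteristic, which starts at [s0], with the one that passes through
    [s0] at a small time [e].  The identity above, taken along both with the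
    same weight, contains the same flux term; subtracting removes the flux and
    bounds the difference of the two transforms at [e] by their difference at a
    fixed time [T] plus a small multiple of the supremum of [|W|] over [[e, T]]
    ([characteristic_comparison]).  At [e] the second transform is [w(e, s0)],
    which converges.  Hence [W] is first bounded ([absorb_half]), and then has
    the same limit as [w(e, s0)] ([transform_along_initial]). *)

(** * Continuous functions on the quadrant *)

(** The product sigma-algebra of the plane contains the open sets: each is a
    countable union of squares with rational centre and half-side. *)
Lemma open_measurable_plane (R : realType) (A : set (R * R)) :
  open A -> measurable A.
Proof.
move=> oA.
pose box (q : rat * rat * rat) : set (R * R) :=
  `]ratr q.1.1 - ratr q.2, ratr q.1.1 + ratr q.2[ `*`
  `]ratr q.1.2 - ratr q.2, ratr q.1.2 + ratr q.2[.
rewrite (_ : A = \bigcup_q (if `[< box q `<=` A >] then box q else set0)); last first.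
  apply/seteqP; split => [[x y] Axy|p [q _]]; last first.
    by case: asboolP => // qA; exact: qA.
  have [e /= e0 eA] : nbhs_ball (x, y) A by rewrite nbhs_ballE; exact: open_nbhs_nbhs.
  have e2 : 0 < e / 2 by rewrite divr_gt0.
  have [r re] : exists r : rat, 0 < (ratr r : R) < e / 2.
    have [r] := @rat_in_itvoo R 0 (e / 2) e2.
    by rewrite in_itv /= => ?; exists r.
  case/andP: re => r0 re.
  (* a centre within r of x gives a square inside the ball of radius 2 r < e *)
  have near_rat (z : R) : exists q : rat, `|z - ratr q| < ratr r.
    have [q] := @rat_in_itvoo R (z - ratr r) (z + ratr r)
      ltac:(by rewrite ltrBlDr -addrA ltrDl addr_gt0).
    rewrite in_itv /= => /andP[q1 q2]; exists q.
    by rewrite ltr_distlC q1.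
  have [p px] := near_rat x; have [q qy] := near_rat y.
  exists (p, q, r) => //.
  have tr (z w : R) (k : rat) : `|z - ratr k| < ratr r ->
     w \in `]ratr k - ratr r, ratr k + ratr r[ -> ball z e w.
    rewrite in_itv/= => zk; rewrite -ltr_distlC => kw.
    rewrite /ball /= -[z - w](subrKA (ratr k)) (le_lt_trans (ler_normD _ _))//.
    by rewrite (le_lt_trans (lerD (ltW zk) (ltW kw)))// [ltRHS]splitr ltrD.
  case: asboolP => [_|]; last first.
    case; case=> [z w] [/= z1 w1]; apply: eA; split => /=.
    - exact: tr px _.
    - exact: tr qy _.
  by split => /=; rewrite in_itv /= -ltr_distlC // distrC.
apply: countable_bigcupT_measurable; first exact: countableP.
by move=> q; case: asboolP => // _; exact: measurableX.
Qed.

Lemma quadrant_continuous_measurable (R : realType) (w : R * R -> R) :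
  (forall p, quadrant p -> {for p, continuous w}) ->
  measurable_fun setT (w \_ quadrant).
Proof.
move=> cw.
have oQ : open (@quadrant R).
  rewrite (_ : quadrant = (fst @^-1` `]0, +oo[) `&` (snd @^-1` `]0, +oo[)); last first.
    by apply/seteqP; split => -[x y]; rewrite /quadrant /= !in_itv /= !andbT.
  apply: openI.
  - by apply: open_comp => [p _|]; [exact: cvg_fst|exact: interval_open].
  - by apply: open_comp => [p _|]; [exact: cvg_snd|exact: interval_open].
have mQ := open_measurable_plane _ _ oQ.
apply/(measurable_restrictT w mQ).
apply: (measurability _ (RGenOpens.measurableE R)) => _ [_ [a [b ->] <-]].
apply: open_measurable_plane.
rewrite openE => p [Qp wp].
rewrite /interior; apply: filterI; first exact: open_nbhs_nbhs.
by apply: (cw _ Qp); apply: open_nbhs_nbhs; split => //; exact: interval_open.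
Qed.

Lemma derivative_bound_increment (R : realType) (f : R -> R) (x y M : R) :
  (forall z, Num.min x y <= z <= Num.max x y -> derivable f z 1 /\ `|derive1 f z| <= M) ->
  `|f y - f x| <= M * `|y - x|.
Proof.
wlog xy : x y / x <= y.
  move=> H; case/orP: (le_total x y) => xy; first exact: H.
  by rewrite minC maxC distrC [`|y - x|]distrC; exact: H.
rewrite min_l // max_r // => H.
have df z : z \in `]x, y[ -> is_derive z 1 f (derive1 f z).
  move=> /subset_itv_oo_cc; rewrite /= in_itv /= => /H[dfz _].
  by rewrite derive1E; exact: derivableP.
have cf : {within `[x, y], continuous f}.
  by apply: derivable_within_continuous => z; rewrite in_itv /= => /H[].
have [c + ->] := MVT_segment xy df cf.
rewrite in_itv /= => /H[_ Mc].
by rewrite normrM ler_wpM2r.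
Qed.

(** Near a point the partial derivative in [t] is bounded, so that [w] is
    Lipschitz in [t] uniformly in [x]. *)
Lemma partial_continuous_jointly_continuous (R : realType) (w : R -> R -> R) :
  (forall t x : R, 0 < t -> 0 < x ->
     derivable (w^~ x) t 1 /\ {for x, continuous (w t)}) ->
  (forall p, quadrant p ->
     {for p, continuous (fun q : R * R => partial_t w q.1 q.2)}) ->
  forall p, quadrant p -> {for p, continuous (fun q : R * R => w q.1 q.2)}.
Proof.
move=> dw cw [t x] [/= t0 x0].
have /cvgrPdist_le/(_ 1 ltr01) := cw (t, x) (conj t0 x0).
move=> /nbhs_ballP[r /= r0 rP].
pose M : R := `|partial_t w t x| + 1.
have M0 : 0 < M by rewrite ltr_wpDl.
have rM (t' x' : R) : ball t r t' -> ball x r x' -> `|partial_t w t' x'| <= M.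
  move=> tr xr; have /= H := rP (t', x') (conj tr xr).
  rewrite /M -lerBlDl (le_trans _ H)// -normrN opprB.
  by rewrite (le_trans _ (lerB_dist _ _)).
apply/cvgrPdist_le => e e0.
have e2 : 0 < e / 2 by rewrite divr_gt0.
have [_ /cvgrPdist_le/(_ _ e2)/nbhs_ballP[d /= d0 dP]] := dw t x t0 x0.
pose k := Num.min (Num.min (Num.min r t) (Num.min x d)) (e / 2 / M).
have k0 : 0 < k by rewrite /k !lt_min r0 t0 x0 d0 !divr_gt0.
exists (ball t k, ball x k).
  by split; exact: nbhsx_ballx.
move=> [t' x'] [/= tk xk].
have [tr xr] : ball t r t' /\ ball x r x'.
  by split; [apply: le_ball tk|apply: le_ball xk];
     rewrite /k !ge_min lexx ?orbT.
have x'0 : 0 < x'.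
  have : ball x x x' by apply: le_ball xk; rewrite /k !ge_min lexx ?orbT.
  by rewrite /ball /= ltr_distlC subrr => /andP[].
have xd : ball x d x' by apply: le_ball xk; rewrite /k !ge_min lexx ?orbT.
rewrite -[w t x - _](subrKA (w t x')) (le_trans (ler_normD _ _))//.
rewrite [leRHS]splitr lerD//; first exact: dP.
have : `|w t x' - w t' x'| <= M * `|t - t'|.
  apply: (@derivative_bound_increment _ (w ^~ x')) => z zt.
  have zr : ball t k z.
    rewrite /ball /=.
    apply: le_lt_trans tk; move: zt; case: (leP t' t) => tt' /andP[z1 z2].
      by rewrite !ger0_norm; lra.
    by rewrite !ler0_norm; lra.
  have z0 : 0 < z.
    have : ball t t z by apply: le_ball zr; rewrite /k !ge_min lexx ?orbT.
    by rewrite /ball /= ltr_distlC subrr => /andP[].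
  split; first exact: (dw z x' z0 x'0).1.
  by apply: rM => //; apply: le_ball zr; rewrite /k !ge_min lexx ?orbT.
move/le_trans; apply; rewrite mulrC -ler_pdivlMr// ltW//.
by apply: (lt_le_trans tk); rewrite /k !ge_min lexx ?orbT.
Qed.

Lemma continuous_bounded_rectangle (R : realType) (w : R * R -> R)
    (t0 t1 d X : R) : 0 < t0 -> 0 < d ->
  (forall p, quadrant p -> {for p, continuous w}) ->
  exists M : R, 0 <= M /\ forall t x, t0 <= t <= t1 -> d <= x <= X ->
    `|w (t, x)| <= M.
Proof.
move=> t00 d0 cw.
have cK : compact (`[t0, t1] `*` `[d, X]).
  by apply: compact_setX; exact: segment_compact.
have /compact_bounded : compact (w @` (`[t0, t1] `*` `[d, X])).
  apply: continuous_compact => //; apply: continuous_in_subspaceT => -[t x].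
  rewrite inE => -[/=]; rewrite !in_itv /= => /andP[tt _] /andP[xx _].
  by apply: cw; split => /=; [exact: lt_le_trans tt|exact: lt_le_trans xx].
move=> [B [_ HB]].
exists (`|B| + 1); split; first by rewrite addr_ge0.
move=> t x tt xx; apply: HB; first by rewrite ltr_pwDr// ler_norm.
by exists (t, x) => //; split; rewrite /= in_itv.
Qed.

(** Uniform integrability bounds the two ends of the half-line, compactness the
    part in between. *)
Lemma laplace_uniform_bound (R : realType) (w : R -> R -> R) (s t0 t1 : R) :
  laplace_uniformly_integrable w ->
  (forall p, quadrant p -> {for p, continuous (fun q : R * R => w q.1 q.2)}) ->
  0 < s -> 0 < t0 -> t0 <= t1 ->
  exists2 M : R, 0 <= M & forall t, t0 <= t <= t1 ->
    (\int[@lebesgue_measure R]_(x in `]0%R, +oo[)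
       `|expR (- (s * x)) * w t x|%:E <= M%:E)%E.
Proof.
move=> [iw uw] cw s0 t00 t01.
have [d [X [d0 dX out]]] := uw s t0 t1 1 s0 t00 t01 ltr01.
have [M [M0 HM]] := continuous_bounded_rectangle _ _ _ t1 _ X t00 d0 cw.
exists (1 + M * (X - d)) => [|t tt].
  by rewrite addr_ge0// mulr_ge0// subr_ge0 ltW.
have tpos : 0 < t by case/andP: tt => + _; exact: lt_le_trans.
have mi := measurable_int _ (integrable_abse (iw _ tpos _ s0)).
have E : `]0, +oo[%classic = (`]0%R, d] `|` `[X, +oo[) `|` `]d, X[ :> set R.
  apply/seteqP; split => x /=; rewrite !in_itv /= ?andbT => H.
    have [xd|dx] := leP x d; first by left; left; rewrite H.
    have [Xx|xX] := leP X x; first by left; right.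
    by right.
  case: H => [[/andP[//]|Xx]|/andP[dx _]].
    by rewrite (lt_le_trans d0)// (le_trans (ltW dX)).
  exact: lt_trans dx.
rewrite E ge0_integral_setU//=; last 3 first.
- exact: measurableU.
- by rewrite -E.
- apply/disj_set2P; apply/seteqP; split => // x /= []; rewrite !in_itv /= andbT.
  by case=> [/andP[_ xd] /andP[]|Xx /andP[_]]; [rewrite ltNge xd|rewrite ltNge Xx].
rewrite EFinD; apply: leeD; first exact: out.
apply: (@le_trans _ _ (\int[@lebesgue_measure R]_(x in `]d, X[) M%:E)%E).
  apply: ge0_le_integral => //=.
  - by apply: measurable_funS mi => //; rewrite E => x; right.
  - move=> x; rewrite in_itv /= => /andP[dx xX]; rewrite lee_fin normrM.
    rewrite ger0_norm ?expR_ge0// -[leRHS]mul1r ler_pM ?expR_ge0//.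
      by rewrite -expR0 ler_expR oppr_le0 mulr_ge0 ?ltW// (lt_trans d0).
    by apply: (HM t x) => //; rewrite !ltW.
rewrite integral_cst//= lebesgue_measure_itv /= lte_fin dX.
by rewrite -EFinD -EFinM lee_fin.
Qed.

(** * Boundary values of a primitive *)

(** Dominated convergence for the restrictions of one integrable function. *)
Lemma cvg_Rintegral_domain (R : realType) (D B : set R) (A : nat -> set R)
    (f : R -> R) : measurable D -> measurable B -> (forall n, measurable (A n)) ->
  B `<=` D -> (forall n, A n `<=` D) ->
  (@lebesgue_measure R).-integrable D (EFin \o f) ->
  (forall x, D x -> \forall n \near \oo, A n x <-> B x) ->
  \int[@lebesgue_measure R]_(x in A n) f x @[n --> \oo] -->
    \int[@lebesgue_measure R]_(x in B) f x.
Proof.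
move=> mD mB mA BD AD intf AB.
have E C : C `<=` D -> \int[@lebesgue_measure R]_(x in C) f x =
    fine (\int[@lebesgue_measure R]_(x in D) (((EFin \o f) \_ C) x))%E.
  by move=> /setIidr {1}<-; rewrite /Rintegral integral_mkcondr.
have ir C : measurable C -> C `<=` D ->
    (@lebesgue_measure R).-integrable D ((EFin \o f) \_ C).
  move=> mC CD; apply/integrable_restrict => //; rewrite (setIidr CD).
  exact: integrableS intf.
under eq_fun do rewrite E//.
rewrite E//; apply: fine_cvg; rewrite fineK; last first.
  by apply: integrable_fin_num => //; exact: ir.
apply: (@dominated_cvg _ _ _ (@lebesgue_measure R) _ _ _ _ (abse \o (EFin \o f))) => //.
- by move=> n; apply: measurable_int; exact: ir.
- move=> x /AB ABx; apply: cvg_near_cst.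
  near=> n; have [H1 H2] : A n x <-> B x by near: n.
  rewrite !patchE; congr (if _ then _ else _).
  by apply/idP/idP; rewrite !inE.
- exact: integrable_abse.
- move=> n x _; rewrite /= patchE; case: ifP => // _.
  by rewrite abse0.
Unshelve. all: by end_near. Qed.

Lemma continuous_FTC2_closed (R : realType) (F f : R -> R) (a b : R) : a < b ->
  (forall x, a <= x <= b -> is_derive x 1 F (f x)) ->
  {within `[a, b], continuous f} ->
  \int[@lebesgue_measure R]_(x in `[a, b]) f x = F b - F a.
Proof.
move=> ab dF cf; rewrite /Rintegral (continuous_FTC2 ab cf (F := F))//.
  have cF : {within `[a, b], continuous F}.
    by apply: derivable_within_continuous => x; rewrite in_itv /= => /dF[].
  have [? ? ?] := (continuous_within_itvP F ab).1 cF.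
  by split => // x /subset_itv_oo_cc; rewrite /= in_itv /= => /dF[].
move=> x /subset_itv_oo_cc; rewrite /= in_itv /= => /dF dFx.
by rewrite derive1E; exact: derive_val.
Qed.

(** The increments of [F] are integrals of [f], whose tails vanish by
    [cvg_Rintegral_domain]. *)
Lemma integrable_derivative_limits (R : realType) (F f : R -> R) :
  (forall x : R, 0 < x -> is_derive x 1 F (f x)) ->
  (forall x : R, 0 < x -> {for x, continuous f}) ->
  (@lebesgue_measure R).-integrable `]0, +oo[ (EFin \o f) ->
  exists l0 l1 : R, [/\ F x @[x --> 0^'+] --> l0, F x @[x --> +oo] --> l1 &
    \int[@lebesgue_measure R]_(x in `]0, +oo[) f x = l1 - l0].
Proof.
move=> dF cf intf.
pose I (x : R) := \int[@lebesgue_measure R]_(y in `]0, x]) f y.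
have sub0 (x : R) : `]0, x] `<=` `]0%R, +oo[.
  by apply: subset_itvl; rewrite bnd_simp.
have FI (x y : R) : 0 < x -> x <= y -> F y - F x = I y - I x.
  move=> x0; rewrite le_eqVlt => /predU1P[->|xy]; first by rewrite !subrr.
  have dFxy z : x <= z <= y -> is_derive z 1 F (f z).
    by move=> /andP[xz _]; apply: dF; exact: lt_le_trans xz.
  have cfxy : {within `[x, y], continuous f}.
    apply: continuous_in_subspaceT => z; rewrite inE /= in_itv /= => /andP[xz _].
    by apply: cf; exact: lt_le_trans xz.
  rewrite -(continuous_FTC2_closed _ _ _ _ _ xy dFxy cfxy).
  rewrite /I Rintegral_itvB//; last 3 first.
  - exact: integrableS intf.
  - by rewrite bnd_simp ltW.
  - by rewrite bnd_simp ltW.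
  rewrite Rintegral_itv_obnd_cbnd//; apply: integrableS intf => //.
  by apply: subset_itv; rewrite bnd_simp// ltW.
have F1 x : 0 < x -> F x = F 1 - I 1 + I x.
  move=> x0; case/orP: (le_total 1 x) => x1.
    by have := FI _ _ ltr01 x1; lra.
  by have := FI _ _ x0 x1; lra.
have I0 : I x @[x --> 0^'+] --> 0.
  apply/cvg_at_rightP => x_ [x0 xl].
  rewrite -[X in _ --> X](Rintegral_set0 (@lebesgue_measure R) f).
  apply: (cvg_Rintegral_domain _ (`]0%R, +oo[ : set R)) => // x /=.
  rewrite in_itv /= andbT => xpos.
  near=> n; split => //; rewrite in_itv /= => /andP[_]; apply/negP.
  by rewrite -ltNge; near: n; exact: (cvgr_lt _ xl).
have Iy : I x @[x --> +oo] --> \int[@lebesgue_measure R]_(x in `]0, +oo[) f x.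
  apply/cvg_pinftyP => x_ xy.
  apply: (cvg_Rintegral_domain _ (`]0%R, +oo[ : set R)) => // x /=.
  rewrite in_itv /= andbT => xpos.
  near=> n; rewrite in_itv /= xpos /=; split => // _.
  by near: n; move/cvgryPge : xy; exact.
exists (F 1 - I 1), (F 1 - I 1 + \int[@lebesgue_measure R]_(x in `]0, +oo[) f x).
split; last by rewrite addrC addKr.
- rewrite -[X in _ --> X]addr0.
  have /cvg_trans : F x @[x --> 0^'+] --> (F 1 - I 1 + I x) @[x --> 0^'+].
    by apply: near_eq_cvg; near=> x; rewrite [RHS]F1.
  by apply; apply: cvgD => //; exact: cvg_cst.
- have /cvg_trans : F x @[x --> +oo] --> (F 1 - I 1 + I x) @[x --> +oo].
    by apply: near_eq_cvg; near=> x; rewrite [RHS]F1.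
  by apply; apply: cvgD => //; exact: cvg_cst.
Unshelve. all: by end_near. Qed.

(** * Laplace integrable functions *)

Lemma laplace_integrableD (R : realType) (g h : R -> R) :
  laplace_integrable g -> laplace_integrable h ->
  laplace_integrable (fun x => g x + h x).
Proof.
move=> ig ih s s0.
apply: eq_integrable (integrableD _ (ig _ s0) (ih _ s0)) => // x _.
by rewrite /= mulrDr EFinD.
Qed.

Lemma laplace_integrableZ (R : realType) (k : R) (h : R -> R) :
  laplace_integrable h -> laplace_integrable (fun x => k * h x).
Proof.
move=> ih s s0; apply: eq_integrable (integrableZl _ k (ih _ s0)) => // x _.
by rewrite /= mulrCA EFinM.
Qed.

Lemma mulx_expR_le (R : realType) (r x : R) : 0 < r -> 0 <= x ->
  x * expR (- (r * x)) <= r^-1.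
Proof.
move=> r0 x0; rewrite expRN ler_pdivrMr ?expR_gt0// mulrC ler_pdivlMr//.
rewrite mulrC; apply: le_trans (expR_ge1Dx _).
by rewrite lerDr.
Qed.

(** The factor [x] costs half of the exponential: [x exp(-s x / 2) <= 2 / s]. *)
Lemma laplace_integrable_mulx (R : realType) (h : R -> R) :
  laplace_integrable h -> laplace_integrable (fun x => x * h x).
Proof.
move=> ih s s0.
have s2 : 0 < s / 2 by rewrite divr_gt0.
have E (x : R) : expR (- (s * x)) * (x * h x) =
    (x * expR (- (s / 2 * x))) * (expR (- (s / 2 * x)) * h x).
  rewrite (_ : - (s * x) = - (s / 2 * x) + - (s / 2 * x)); last by field.
  by rewrite expRD; ring.
apply: le_integrable (integrableZl _ (s / 2)^-1 (ih _ s2)) => //.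
  have /measurable_EFinP mh := measurable_int _ (ih _ s0).
  apply/measurable_EFinP.
  rewrite (_ : (fun _ => _) = (fun x : R => x * (expR (- (s * x)) * h x))).
    by apply: measurable_funM.
  by apply/funext => x; rewrite mulrCA.
move=> x /=; rewrite in_itv /= andbT => x0.
rewrite lee_fin E normrM [leRHS]normrM ler_wpM2r//.
rewrite !ger0_norm; first exact: mulx_expR_le s2 (ltW x0).
  by rewrite invr_ge0 ltW.
by rewrite mulr_ge0 ?expR_ge0// ltW.
Qed.

(** * Derivatives of explicit expressions *)

(* Rules for expressions in a bound variable, applied by [derive_by] below. *)
Section PointwiseDerivatives.
Context {R : realType}.
Implicit Types (f g : R -> R) (x df dg k : R).

Lemma is_derive_fun_cst k x : is_derive x 1 (fun _ : R => k) 0.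
Proof. exact: is_derive_cst. Qed.

Lemma is_derive_fun_id x : is_derive x 1 (fun z : R => z) 1.
Proof. exact: is_derive_id. Qed.

Lemma is_derive_fun_add {f g x df dg} :
  is_derive x 1 f df -> is_derive x 1 g dg ->
  is_derive x 1 (fun z => f z + g z) (df + dg).
Proof. exact: is_deriveD. Qed.

Lemma is_derive_fun_opp {f x df} :
  is_derive x 1 f df -> is_derive x 1 (fun z => - f z) (- df).
Proof. exact: is_deriveN. Qed.

Lemma is_derive_fun_mul {f g x df dg} :
  is_derive x 1 f df -> is_derive x 1 g dg ->
  is_derive x 1 (fun z => f z * g z) (df * g x + f x * dg).
Proof.
move=> Hf Hg; apply: is_derive_eq (is_deriveM Hf Hg) _.
by rewrite addrC /GRing.scale /= [g x * _]mulrC.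
Qed.

Lemma is_derive_fun_comp {f g x df dg} :
  is_derive (g x) 1 f df -> is_derive x 1 g dg ->
  is_derive x 1 (fun z => f (g z)) (df * dg).
Proof.
move=> [f1 f2] [g1 g2]; split.
  apply/derivable1_diffP; apply: differentiable_comp; exact/derivable1_diffP.
by rewrite -derive1E (derive1_comp g1 f1) !derive1E f2 g2.
Qed.

Lemma is_derive_fun_exp {f x df} :
  is_derive x 1 f df -> is_derive x 1 (fun z => expR (f z)) (expR (f x) * df).
Proof. by move=> H; apply: is_derive_fun_comp H. Qed.

Lemma is_derive_fun_inv {f x df} : f x != 0 ->
  is_derive x 1 f df -> is_derive x 1 (fun z => (f z)^-1) (- df / (f x) ^+ 2).
Proof.
move=> fx [f1 f2]; split; first exact: derivableV.
by rewrite deriveV// f2 /GRing.scale /= mulrC mulrN mulNr.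
Qed.

Lemma is_derive_continuous {f x df} :
  is_derive x 1 f df -> {for x, continuous f}.
Proof.
by case=> fx _; apply: differentiable_continuous; exact/derivable1_diffP.
Qed.

Lemma derivable_is_derive1 {f x} : derivable f x 1 -> is_derive x 1 f (derive1 f x).
Proof. by rewrite derive1E; exact: derivableP. Qed.

Lemma is_derive1E {f x df} : is_derive x 1 f df -> derive1 f x = df.
Proof. by move=> H; rewrite derive1E; exact: derive_val. Qed.

End PointwiseDerivatives.

Ltac derive_rules := repeat first
  [ eassumption | eapply is_derive_fun_cst | eapply is_derive_fun_id
  | eapply is_derive_fun_opp | eapply is_derive_fun_add
  | eapply is_derive_fun_mul | eapply is_derive_fun_exp ].

(* Reduces a derivative to an identity between real numbers. *)
Ltac derive_by := eapply is_derive_eq; [solve [derive_rules] | rewrite /=].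

(** * The transformed equation at a fixed time *)

(** The mass of [k / x] on [[d exp(-N), d]] is [k N], hence unbounded. *)
Lemma integrable_no_simple_pole (R : realType) (h : R -> R) (d k : R) :
  0 < d -> 0 < k -> (@lebesgue_measure R).-integrable `]0, +oo[ (EFin \o h) ->
  (forall x, 0 < x <= d -> k / x <= `|h x|) -> False.
Proof.
move=> d0 k0 ih hk.
set mu := @lebesgue_measure R.
pose B := \int[mu]_(x in `]0, +oo[) `|h x|.
have inh : mu.-integrable `]0, +oo[ (EFin \o (fun x => `|h x|)).
  exact: integrable_norm.
have B0 : 0 <= B by apply: Rintegral_ge0.
(* N is such that k N exceeds the integral B *)
pose N := B / k + 1.
have N0 : 0 < N by rewrite ltr_wpDl// divr_ge0// ltW.
pose e := d * expR (- N).
have e0 : 0 < e by rewrite mulr_gt0// expR_gt0.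
have ed : e < d by rewrite /e -[ltRHS]mulr1 ltr_pM2l// -expR0 ltr_expR oppr_lt0.
have dln (x : R) : e <= x <= d -> is_derive x 1 (fun x => k * ln x) (k / x).
  move=> /andP[ex _]; have x0 : 0 < x by exact: lt_le_trans ex.
  have H := is_derive1_ln x0; derive_by.
  by rewrite mul0r add0r.
have cinv : {within `[e, d], continuous (fun x : R => k / x)}.
  apply: continuous_in_subspaceT => z; rewrite inE /= in_itv /= => /andP[ez _].
  apply: cvgM; first exact: cvg_cst.
  by apply: cvgV; [rewrite gt_eqF// (lt_le_trans e0)|exact: cvg_id].
have := continuous_FTC2_closed _ _ _ _ _ ed dln cinv.
rewrite -mulrBr {2}/e lnM ?posrE ?expR_gt0// expRK subKr => I.
have sub : `[e, d]%classic `<=` (`]0, +oo[ : set R).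
  by apply: subset_itv; rewrite bnd_simp.
have : k * N <= B.
  rewrite -I; apply: (@le_trans _ _ (\int[mu]_(x in `[e, d]) `|h x|)).
    apply: le_Rintegral => //.
    - apply: continuous_compact_integrable => //; exact: segment_compact.
    - exact: integrableS inh.
    - move=> x; rewrite /= in_itv /= => /andP[ex xd].
      by apply: hk; rewrite xd andbT (lt_le_trans e0).
  rewrite /B /Rintegral fine_le//.
  - apply: integrable_fin_num => //; exact: integrableS inh.
  - exact: integrable_fin_num.
  - apply: ge0_subset_integral => //.
    exact: measurable_int inh.
by rewrite /N mulrDr mulrCA divff ?gt_eqF// !mulr1; lra.
Qed.

(** With [y = al x U] and [J = y' - (b x + c) U], the integrand is the derivative
    of [Phi s = exp(-s x) (J + s y)].  It is integrable for every [s], so that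
    [Phi s] has limits at both ends for every [s].  At infinity the limit is 0 by
    comparison with smaller values of [s].  At the origin [J] tends to [- k] and
    so [y] has a limit, which is 0 since otherwise [U] would have a pole. *)
Lemma flux_transform (R : realType) (al b c s k : R) (U V : R -> R) :
  0 < al -> 0 < s ->
  (forall x : R, 0 < x -> derivable U x 1 /\ derivable (derive1 U) x 1) ->
  (forall x : R, 0 < x -> {for x, continuous V}) ->
  laplace_integrable U -> laplace_integrable V ->
  (forall x : R, 0 < x -> V x = derive1n 2 (fun x => al * x * U x) x -
     derive1 (fun x => (b * x + c) * U x) x) ->
  - (derive1 (fun x => al * x * U x) x - (b * x + c) * U x)
    @[x --> 0^'+] --> k ->
  \int[@lebesgue_measure R]_(x in `]0, +oo[)
    (expR (- (s * x)) * (V x + (s * (b * x + c) - s ^+ 2 * (al * x)) * U x))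
  = k.
Proof.
move=> al0 s0 dU cV iU iV eqV flux.
pose y x := al * x * U x.
pose J (x : R) : R := derive1 y x - (b * x + c) * U x.
pose Phi (r x : R) : R := expR (- (r * x)) * (J x + r * y x).
pose phi (r x : R) : R :=
  expR (- (r * x)) * (V x + (r * (b * x + c) - r ^+ 2 * (al * x)) * U x).
have dy (x : R) : 0 < x -> is_derive x 1 y (al * U x + al * x * derive1 U x).
  move=> x0; have dUx : is_derive x 1 U (derive1 U x).
    by rewrite derive1E; exact/derivableP/(dU _ x0).1.
  by rewrite /y; derive_by; ring.
have dJ (x : R) : 0 < x -> is_derive x 1 J (V x).
  move=> x0.
  have ddy : derivable (derive1 y) x 1.
    apply: (@near_eq_derivable _ _ _ (fun z => al * U z + al * z * derive1 U z)) => //.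
      near=> z; have z0 : 0 < z by near: z; exact: lt_nbhsr.
      by rewrite (is_derive1E (dy _ z0)).
    have H1 := derivable_is_derive1 (dU _ x0).1.
    have H2 := derivable_is_derive1 (dU _ x0).2.
    suff : is_derive x 1 (fun z => al * U z + al * z * derive1 U z)
      (al * derive1 U x + (al * derive1 U x + al * x * derive1 (derive1 U) x)) by case.
    by derive_by; ring.
  have H1 := derivable_is_derive1 ddy.
  have H2 : is_derive x 1 (fun x => (b * x + c) * U x)
      (derive1 (fun x => (b * x + c) * U x) x).
    apply: derivable_is_derive1.
    have H2 := derivable_is_derive1 (dU _ x0).1.
    suff : is_derive x 1 (fun x => (b * x + c) * U x) (b * U x + (b * x + c) * derive1 U x) by case.
    by derive_by; ring.
  by apply: is_derive_eq (is_derive_fun_add H1 (is_derive_fun_opp H2)) _; rewrite [RHS]eqV.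
have dPhi r (x : R) : 0 < x -> is_derive x 1 (Phi r) (phi r x).
  move=> x0; have HJ := dJ _ x0; have Hy := dy _ x0.
  rewrite /Phi; derive_by.
  rewrite /phi /J (is_derive1E Hy) /y /=; ring.
have cphi r (x : R) : 0 < x -> {for x, continuous (phi r)}.
  move=> x0.
  have c1 : {for x, continuous (fun z : R => expR (- (r * z)))}.
    have : is_derive x 1 (fun z : R => expR (- (r * z))) (- r * expR (- (r * x))).
      by derive_by; ring.
    exact: is_derive_continuous.
  have c2 : {for x, continuous (fun z => (r * (b * z + c) - r ^+ 2 * (al * z)) * U z)}.
    have HU := derivable_is_derive1 (dU _ x0).1.
    have : is_derive x 1 (fun z => (r * (b * z + c) - r ^+ 2 * (al * z)) * U z)
      ((r * b - r ^+ 2 * al) * U x + (r * (b * x + c) - r ^+ 2 * (al * x)) * derive1 U x).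
      by derive_by; ring.
    exact: is_derive_continuous.
  by apply: cvgM; [exact: c1|apply: cvgD; [exact: cV|exact: c2]].
have iphi r : 0 < r ->
    (@lebesgue_measure R).-integrable `]0, +oo[ (EFin \o phi r).
  move=> r0.
  have : laplace_integrable (fun x => V x + ((r * c) * U x + (r * b - r ^+ 2 * al) * (x * U x))).
    apply: laplace_integrableD => //.
    apply: laplace_integrableD; first exact: laplace_integrableZ.
    by apply: laplace_integrableZ; exact: laplace_integrable_mulx.
  move=> /(_ _ r0); apply: eq_integrable => // x _ /=; congr EFin.
  by rewrite /phi; congr (_ * _); ring.
have lims r : 0 < r -> exists l0 l1 : R, [/\ Phi r x @[x --> 0^'+] --> l0,
    Phi r x @[x --> +oo] --> l1 &
    \int[@lebesgue_measure R]_(x in `]0, +oo[) phi r x = l1 - l0].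
  move=> r0; apply: (integrable_derivative_limits _ (Phi r) (phi r)).
  - by move=> x; exact: cphi.
  - exact: iphi.
have cexp r : expR (r * x) @[x --> 0^'+] --> (1 : R).
  have : is_derive (0 : R) 1 (fun z : R => expR (r * z)) r.
    by derive_by; rewrite mulr0 expR0; ring.
  move/is_derive_continuous => H; apply: cvg_at_right_filter.
  have <- : expR (r * 0) = 1 by rewrite mulr0 expR0.
  exact: H.
have exp_oo r : 0 < r -> expR (- (r * x)) @[x --> +oo] --> (0 : R).
  move=> r0; apply: (@cvg_comp _ _ _ (fun x => r * x) (fun x => expR (- x)) _ (pinfty_nbhs R)).
    exact: gt0_cvgMry.
  exact: cvgr_expR.
(* r |-> J + r y is affine, so that its value at s is 4 times the value at s / 2
   minus 3 times the value at s / 3; these two values, multiplied by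
   exp(- s x / 2) and exp(- s x / 3), converge *)
have Phi_oo : Phi s x @[x --> +oo] --> 0.
  have [_ [l [_ Hl _]]] := lims (s / 2) ltac:(by rewrite divr_gt0).
  have [_ [l' [_ Hl' _]]] := lims (s / 3) ltac:(by rewrite divr_gt0).
  rewrite (_ : Phi s = fun x => 4 * (expR (- (s / 2 * x)) * Phi (s / 2) x)
    - 3 * (expR (- (2 * s / 3 * x)) * Phi (s / 3) x)); last first.
    apply/funext => x; rewrite /Phi 2!(mulrA (expR _) (expR _)) -2!expRD.
    rewrite (_ : - (s / 2 * x) - s / 2 * x = - (s * x)); last by field.
    rewrite (_ : - (2 * s / 3 * x) - s / 3 * x = - (s * x)); last by field.
    by field.
  rewrite (_ : 0 = 4 * (0 * l) - 3 * (0 * l')); last by ring.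
  apply: cvgB; (apply: cvgM; first exact: cvg_cst);
    (apply: cvgM => //; apply: exp_oo; by rewrite !(divr_gt0, mulr_gt0)).
have J0 : J x @[x --> 0^'+] --> - k.
  rewrite (_ : J = fun x => - - J x); last by apply/funext => x; rewrite opprK.
  exact: cvgN.
have [l0 [_ [Hl0 _ _]]] := lims _ s0.
(* solving Phi s = exp(-s x) (J + s y) for y *)
have yE x : y x = s^-1 * (expR (s * x) * Phi s x - J x).
  by rewrite /Phi mulrA -expRD subrr expR0; field; rewrite gt_eqF.
pose Y := s^-1 * (1 * l0 - - k).
have yY : y x @[x --> 0^'+] --> Y.
  rewrite (_ : y = fun x => s^-1 * (expR (s * x) * Phi s x - J x)); last exact/funext.
  apply: cvgM; first exact: cvg_cst.
  by apply: cvgB => //; apply: cvgM.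
have Y0 : Y = 0.
  apply/eqP; apply: contrapT => /negP Y0.
  have absY : 0 < `|Y| / 2 by rewrite divr_gt0// normr_gt0.
  move/cvgrPdist_le : yY => /(_ _ absY)[d /= d0 dP].
  pose d' := d / 2; have d'0 : 0 < d' by rewrite divr_gt0.
  apply: (integrable_no_simple_pole _ _ d' (`|Y| / 2 / al * expR (- d')) d'0 _ (iU 1 ltr01)).
    by rewrite mulr_gt0 ?expR_gt0// divr_gt0.
  move=> x /andP[x0 xd'].
  have : `|Y - y x| <= `|Y| / 2.
    apply: dP => //=; rewrite sub0r normrN gtr0_norm//.
    by rewrite (le_lt_trans xd')// /d' ltr_pdivrMr// ltr_pMr// ltr1n.
  move=> YyP.
  have {YyP} : `|Y| / 2 <= `|y x| by have := lerB_dist Y (y x); lra.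
  rewrite /y (normrM (al * x)) (gtr0_norm (mulr_gt0 al0 x0)) => H.
  rewrite [leRHS]normrM (gtr0_norm (expR_gt0 _)) mul1r.
  rewrite [leLHS](_ : _ = expR (- d') * (`|Y| / 2 / (al * x))); last first.
    by field; rewrite !gt_eqF.
  rewrite ler_pM ?expR_ge0//.
  - by rewrite divr_ge0 ?mulr_ge0// ltW.
  - by rewrite ler_expR lerN2.
  - by rewrite ler_pdivrMr ?mulr_gt0// [leRHS]mulrC.
have Phi_0 : Phi s x @[x --> 0^'+] --> - k.
  rewrite -[- k]mul1r; apply: cvgM.
    by under eq_fun do rewrite -mulNr; exact: cexp.
  rewrite -[- k]addr0; apply: cvgD => //.
  rewrite Y0 in yY.
  have : s * y x @[x --> 0^'+] --> s * 0 by apply: cvgM => //; exact: cvg_cst.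
  by rewrite mulr0.
have [l2 [l1 [H0 H1 ->]]] := lims _ s0.
have -> : l2 = - k by exact: cvg_unique H0 Phi_0.
have -> : l1 = 0 by exact: cvg_unique H1 Phi_oo.
by rewrite opprK add0r.
Unshelve. all: by end_near. Qed.

(** * The identity along a characteristic *)

Lemma segment_continuous_bounded (R : realType) (h : R -> R) (a b : R) :
  {within `[a, b], continuous h} ->
  exists M : R, 0 <= M /\ forall x, a <= x <= b -> `|h x| <= M.
Proof.
move=> ch.
have /compact_bounded[B [_ HB]] : compact (h @` `[a, b]).
  by apply: continuous_compact => //; exact: segment_compact.
exists (`|B| + 1); split; first by rewrite addr_ge0.
move=> x xab; apply: HB; first by rewrite ltr_pwDr// ler_norm.
by exists x => //; rewrite /= in_itv.
Qed.

Lemma segment_continuous_positive (R : realType) (h : R -> R) (a b : R) :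
  a <= b -> {within `[a, b], continuous h} ->
  (forall x, a <= x <= b -> 0 < h x) ->
  exists2 d : R, 0 < d & forall x, a <= x <= b -> d <= h x.
Proof.
move=> ab ch h0; have [z] := EVT_min ab ch.
rewrite in_itv /= => /h0 hz0 hz; by exists (h z).
Qed.

Lemma segment_continuous_measurable (R : realType) (h : R -> R) (a b : R) :
  {within `[a, b], continuous h} -> measurable_fun setT (h \_ `[a, b]).
Proof.
move=> ch; apply/(@measurable_restrictT _ _ _ _ (`[a, b] : set R)) => //.
exact: subspace_continuous_measurable_fun.
Qed.

(** Fubini on the strip [[t0, t1] x (0, oo)] for [h = dH/dt].  The function [hh],
    which extends [h] by 0 to the whole plane, carries the joint measurability;
    [B] bounds the mass of [h] uniformly in time. *)
Section StripFubini.
Context {R : realType}.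
Notation mu := (@lebesgue_measure R).

Lemma strip_fubini (t0 t1 B : R) (h H : R -> R -> R)
    (w : R -> R) (hh : R * R -> R) :
  t0 < t1 -> measurable_fun setT hh ->
  (forall p, hh p =
     if (p.1 \in `[t0, t1]) && (0 < p.2) then h p.1 p.2 else 0) ->
  (forall t : R, t0 <= t <= t1 ->
     (\int[mu]_(x in `]0%R, +oo[) `|h t x|%:E <= B%:E)%E) ->
  (forall t : R, t0 <= t <= t1 ->
     (\int[mu]_(x in `]0%R, +oo[) (h t x)%:E = (w t)%:E)%E) ->
  (forall x : R, 0 < x ->
     (\int[mu]_(t in `[t0, t1]) (h t x)%:E =
      (H t1 x - H t0 x)%:E)%E) ->
  mu.-integrable `[t0, t1] (EFin \o w) /\
  \int[mu]_(t in `[t0, t1]) w t =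
  \int[mu]_(x in `]0, +oo[) (H t1 x - H t0 x).
Proof.
move=> t01 mhh hhE hB hw hH.
have mF : measurable_fun setT (EFin \o hh) by exact/measurable_EFinP.
have xin (t : R) (G : R -> \bar R) : G 0%R = 0%E ->
    (\int[mu]_x G (hh (t, x)) =
     if (t \in `[t0, t1]) then \int[mu]_(x in `]0%R, +oo[) G (h t x) else 0)%E.
  move=> G0; case: ifPn => tI.
    rewrite [RHS]integral_mkcond; apply: eq_integral => x _.
    rewrite patchE hhE /= tI /= mem_setE in_itv /= andbT.
    by case: ifP.
  by under eq_integral do rewrite hhE /= (negbTE tI) /= G0; rewrite integral0.
have tin (x : R) : (\int[mu]_t (hh (t, x))%:E =
     if (0 < x)%R then (H t1 x - H t0 x)%:E else 0)%E.
  case: ifPn => x0.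
    rewrite -hH// [RHS]integral_mkcond; apply: eq_integral => t _.
    by rewrite patchE hhE /= x0 andbT mem_setE; case: ifP.
  by under eq_integral do rewrite hhE /= (negbTE x0) andbF; rewrite integral0.
have ihh : (mu \x mu)%E.-integrable setT (EFin \o hh).
  apply/integrable12ltyP => //.
  apply: (@le_lt_trans _ _ (\int[mu]_t (((cst B%:E) \_ `[t0, t1]) t))%E).
    apply: ge0_le_integral => //.
    - by move=> t _; exact: integral_ge0.
    - have mabs : measurable_fun setT (abse \o (EFin \o hh)).
        exact: measurableT_comp.
      exact: (@measurable_fun_fubini_tonelli_F _ _
        (measurableTypeR R) (measurableTypeR R) _ mu _ mabs (fun=> abse_ge0 _)).
    - by apply/(@measurable_restrictT _ _ _ _ (`[t0, t1] : set R)).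
    - move=> t _; rewrite (xin _ (fun z => `|z%:E|%E)) ?abse0// patchE mem_setE.
      by case: ifPn => // tI; apply: hB; move: tI; rewrite in_itv.
  rewrite -integral_mkcond integral_cst//= lebesgue_measure_itv /= lte_fin t01.
  by rewrite -EFinD -EFinM ltry.
have wE t : t \in `[t0, t1] -> (\int[mu]_x (hh (t, x))%:E = (w t)%:E)%E.
  by move=> tI; rewrite (xin _ EFin) ?tI// hw//; move: tI; rewrite in_itv.
split.
  have iF := integrable_fubini_F ihh.
  have iFI : mu.-integrable `[t0, t1] (fubini_F mu (EFin \o hh)).
    exact: integrableS iF.
  apply: eq_integrable iFI => // t; rewrite mem_setE => tI.
  by rewrite /fubini_F /= wE.
have := Fubini ihh.
under eq_integral do rewrite /= (xin _ EFin)//.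
under [in RHS]eq_integral do rewrite /= tin.
rewrite /Rintegral => E; congr fine.
rewrite integral_mkcond [RHS]integral_mkcond.
transitivity (\int[mu]_t (if t \in `[t0, t1] then
    \int[mu]_(x in `]0%R, +oo[) (h t x)%:E else 0))%E.
  apply: eq_integral => t _; rewrite patchE mem_setE; case: ifP => // tI.
  by rewrite hw//; move: tI; rewrite in_itv.
rewrite E; apply: eq_integral => x _.
by rewrite patchE mem_setE in_itv /= andbT.
Qed.

End StripFubini.

Section CharacteristicIdentity.
Context {R : realType}.
Notation mu := (@lebesgue_measure R).
Context (a b c v : R) (u : R -> R -> R) (f : R -> R).
Context (a_gt0 : 0 < a) (u_sol : is_solution a b c v u)
  (f_flux : is_flux a b c v u f).

Lemma solution_continuous p :
  quadrant p -> {for p, continuous (fun q : R * R => u q.1 q.2)}.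
Proof.
have [du cu _ _ _] := u_sol.
apply: partial_continuous_jointly_continuous; last by move=> q /cu[].
move=> t x t0 x0; have [dt dx _] := du t x t0 x0; split => //.
exact: is_derive_continuous (derivableP dx).
Qed.

Lemma continuous_slice_x (w : R -> R -> R) (t x : R) : 0 < t -> 0 < x ->
  (forall p, quadrant p -> {for p, continuous (fun q : R * R => w q.1 q.2)}) ->
  {for x, continuous (w t)}.
Proof.
move=> t0 x0 cw; have H := cw (t, x) (conj t0 x0).
apply: (@continuous_comp _ _ _ (fun z => (t, z)) (fun q : R * R => w q.1 q.2)) => //.
move=> A [[B C] [/= tB xC] BC]; apply: filterS xC => z Cz; apply: BC.
by split => //=; exact: nbhs_singleton tB.
Qed.

Lemma continuous_slice_t (w : R -> R -> R) (t x : R) : 0 < t -> 0 < x ->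
  (forall p, quadrant p -> {for p, continuous (fun q : R * R => w q.1 q.2)}) ->
  {for t, continuous (w ^~ x)}.
Proof.
move=> t0 x0 cw; have H := cw (t, x) (conj t0 x0).
apply: (@continuous_comp _ _ _ (fun z => (z, x)) (fun q : R * R => w q.1 q.2)) => //.
move=> A [[B C] [/= tB xC] BC]; apply: filterS tB => z Bz; apply: BC.
by split => //=; exact: nbhs_singleton xC.
Qed.

(** The transformed equation: [exp(-s x) u_t] and the terms with [x u] and [u]
    stand for [w_t], [- w_s] and [w]. *)
Lemma laplace_flux (t s : R) : 0 < t -> 0 < s ->
  \int[mu]_(x in `]0, +oo[) (expR (- (s * x)) * (partial_t u t x +
    (s * (b * x + c) - s ^+ 2 * (a * t `^ (2 * v - 1) * x)) * u t x)) = f t.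
Proof.
move=> t0 s0; have [du cu eqn [iu _] [iut _]] := u_sol.
apply: flux_transform.
- by rewrite mulr_gt0// powR_gt0.
- by [].
- by move=> x x0; have [] := du t x t0 x0.
- move=> x x0; apply: continuous_slice_x => // p /cu[] //.
- exact: iu.
- exact: iut.
- by move=> x x0; exact: eqn.
- exact: f_flux.
Qed.

Lemma laplace_integrable_slice (t s : R) : 0 < t -> 0 < s ->
  mu.-integrable `]0, +oo[ (EFin \o (fun x => expR (- (s * x)) * u t x)).
Proof. by move=> t0 s0; have [_ _ _ [iu _] _] := u_sol; exact: iu. Qed.

(** The [t]-derivative of [m(t) exp(- s(t) x) u(t, x)] when [m'] is the derivative
    of [m] and [s] solves [s' = a t^(2v-1) s^2 - b s]. *)
Definition characteristic_density (m m' s : R -> R) (t x : R) : R :=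
  m' t * (expR (- (s t * x)) * u t x)
  + m t * (expR (- (s t * x)) * partial_t u t x)
  - m t * (a * t `^ (2 * v - 1) * s t ^+ 2 - b * s t) * (x * (expR (- (s t * x)) * u t x)).

(** The choice of [s'] cancels the terms that contain [x u], that is [w_s]. *)
Lemma integral_characteristic_density (m m' s : R -> R) (t : R) :
  0 < t -> 0 < s t ->
  mu.-integrable `]0, +oo[ (EFin \o characteristic_density m m' s t) /\
  (\int[mu]_(x in `]0%R, +oo[) (characteristic_density m m' s t x)%:E =
  (m t * f t + (m' t - c * s t * m t) * laplace (u t) (s t))%:E)%E.
Proof.
move=> t0 s0.
have [_ _ _ [iu _] [iut _]] := u_sol.
set al := a * t `^ (2 * v - 1).
pose A x := expR (- (s t * x)) * (partial_t u t x +
    (s t * (b * x + c) - s t ^+ 2 * (al * x)) * u t x).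
pose B x := expR (- (s t * x)) * u t x.
have iB : mu.-integrable `]0, +oo[ (EFin \o B) by exact: laplace_integrable_slice.
have iA : mu.-integrable `]0, +oo[ (EFin \o A).
  have : laplace_integrable (fun x => partial_t u t x + ((s t * c) * u t x
      + (s t * b - s t ^+ 2 * al) * (x * u t x))).
    apply: laplace_integrableD; first exact: iut.
    apply: laplace_integrableD; first by apply: laplace_integrableZ; exact: iu.
    by apply/laplace_integrableZ/laplace_integrable_mulx; exact: iu.
  move=> /(_ _ s0); apply: eq_integrable => // x _ /=; congr EFin.
  by rewrite /A; congr (_ * _); ring.
have E (x : R) : (characteristic_density m m' s t x)%:E =
    ((m t)%:E * (A x)%:E + (m' t - c * s t * m t)%:E * (B x)%:E)%E.
  rewrite -!EFinM -EFinD; congr EFin.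
  by rewrite /characteristic_density /A /B -/al; ring.
have imA : mu.-integrable `]0, +oo[ (fun x => (m t)%:E * (A x)%:E)%E.
  exact: integrableZl iA.
have imB : mu.-integrable `]0, +oo[
    (fun x => (m' t - c * s t * m t)%:E * (B x)%:E)%E.
  exact: integrableZl iB.
split.
  by apply: eq_integrable (integrableD _ imA imB) => // x _; rewrite /= E.
under eq_integral do rewrite E.
rewrite integralD//.
rewrite !integralZl//.
have -> : (\int[mu]_(x in `]0%R, +oo[) (A x)%:E = (f t)%:E)%E.
  rewrite -(laplace_flux t (s t) t0 s0) /Rintegral fineK//.
  exact: integrable_fin_num.
have -> : (\int[mu]_(x in `]0%R, +oo[) (B x)%:E = (laplace (u t) (s t))%:E)%E.
  by rewrite /laplace /Rintegral fineK//; exact: integrable_fin_num.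
by rewrite -!EFinM -EFinD.
Qed.


Context (t0 t1 : R) (m m' s : R -> R).
Context (t0_gt0 : 0 < t0) (t01 : t0 < t1)
  (cm : {within `[t0, t1], continuous m})
  (cm' : {within `[t0, t1], continuous m'})
  (dm : forall t, t0 < t < t1 -> is_derive t 1 m (m' t))
  (s_gt0 : forall t, t0 <= t <= t1 -> 0 < s t)
  (ds : forall t, t0 <= t <= t1 ->
    is_derive t 1 s (a * t `^ (2 * v - 1) * s t ^+ 2 - b * s t)).

Let s' (t : R) : R := a * t `^ (2 * v - 1) * s t ^+ 2 - b * s t.

Let time_gt0 (t : R) : t0 <= t <= t1 -> 0 < t.
Proof. by case/andP => + _; exact: lt_le_trans. Qed.

Let cs (t : R) : t0 <= t <= t1 -> {for t, continuous s}.
Proof. by move=> /ds /is_derive_continuous. Qed.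

Let cs' (t : R) : t0 <= t <= t1 -> {for t, continuous s'}.
Proof.
move=> tI; have tgt0 := time_gt0 _ tI.
apply: cvgB; last by apply: cvgM; [exact: cvg_cst|exact: cs].
apply: cvgM.
  apply: cvgM; first exact: cvg_cst.
  exact: is_derive_continuous (is_derive1_powR (2 * v - 1) tgt0).
by apply: cvgM; exact: cs.
Qed.

Let within_of (h : R -> R) :
  (forall t, t0 <= t <= t1 -> {for t, continuous h}) ->
  {within `[t0, t1], continuous h}.
Proof.
move=> ch; apply: continuous_in_subspaceT => z.
by rewrite inE /= in_itv /=; exact: ch.
Qed.

(* s >= d = 2 r on the time interval; one factor exp(- r x) absorbs the factor x
   and the other one is kept for the uniform integrability of u and u_t *)
Let density_bound : exists B : R, forall t, t0 <= t <= t1 ->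
  (\int[mu]_(x in `]0%R, +oo[) `|characteristic_density m m' s t x|%:E <= B%:E)%E.
Proof.
have [Km [Km0 HKm]] := segment_continuous_bounded _ _ _ _ cm.
have [Km' [Km'0 HKm']] := segment_continuous_bounded _ _ _ _ cm'.
have [Ks [Ks0 HKs]] := segment_continuous_bounded _ _ _ _ (within_of _ cs').
have [d d0 Hd] := segment_continuous_positive _ _ _ _ (ltW t01) (within_of _ cs) s_gt0.
have [r r0 rd] : exists2 r : R, 0 < r & r + r = d.
  by exists (d / 2); [rewrite divr_gt0|rewrite -splitr].
have [_ cu _ iu iut] := u_sol.
have [M1 M10 HM1] := laplace_uniform_bound _ _ r t0 t1 iu solution_continuous r0 t0_gt0 (ltW t01).
have [M2 M20 HM2] := laplace_uniform_bound _ _ r t0 t1 iut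
  (fun p Qp => let: And3 H _ _ := cu p Qp in H) r0 t0_gt0 (ltW t01).
pose K1 := Km' + Km * Ks / r.
have K10 : 0 <= K1 by rewrite addr_ge0// divr_ge0 ?mulr_ge0// ltW.
exists (K1 * M1 + Km * M2) => t tI; have tgt0 := time_gt0 _ tI.
have [idens _] := integral_characteristic_density m m' s t tgt0 (s_gt0 _ tI).
have [_ _ _ [iu1 _] [iut1 _]] := u_sol.
have m1 := measurable_int _ (integrable_abse (iu1 _ tgt0 _ r0)).
have m2 := measurable_int _ (integrable_abse (iut1 _ tgt0 _ r0)).
apply: (@le_trans _ _ (\int[mu]_(x in `]0%R, +oo[)
   (K1%:E * `|expR (- (r * x)) * u t x|%:E
    + Km%:E * `|expR (- (r * x)) * partial_t u t x|%:E))%E).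
  apply: ge0_le_integral => //.
  - exact: measurable_int (integrable_abse idens).
  - apply: emeasurable_funD; apply: measurable_funeM; [exact: m1|exact: m2].
  - move=> x; rewrite /= in_itv /= andbT => x0.
    rewrite -!EFinM -EFinD lee_fin.
    have es : expR (- (s t * x)) <= expR (- (r * x)) * expR (- (r * x)).
      rewrite -expRD ler_expR -opprD -mulrDl lerN2 ler_wpM2r ?(ltW x0)//.
      by rewrite rd; exact: Hd.
    have e0 := expR_ge0 (- (r * x)).
    have e1 : expR (- (r * x)) <= 1.
      by rewrite -expR0 ler_expR oppr_le0 mulr_ge0 ?ltW.
    have ee : expR (- (s t * x)) <= expR (- (r * x)).
      by apply: le_trans es _; rewrite ler_piMl.
    have EV (y : R) : `|expR (- (s t * x)) * y| <= `|expR (- (r * x)) * y|.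
      by rewrite !normrM !(ger0_norm (expR_ge0 _)) ler_wpM2r.
    have xE : `|x * (expR (- (s t * x)) * u t x)| <= r^-1 * `|expR (- (r * x)) * u t x|.
      rewrite !normrM !(ger0_norm (expR_ge0 _)) (gtr0_norm x0) !mulrA ler_wpM2r//.
      apply: (@le_trans _ _ (x * (expR (- (r * x)) * expR (- (r * x))))).
        by rewrite ler_wpM2l// ltW.
      by rewrite mulrA ler_wpM2r// mulx_expR_le// ltW.
    rewrite /characteristic_density -/(s' t).
    apply: le_trans (ler_normB _ _) _; apply: le_trans (lerD (ler_normD _ _) (lexx _)) _.
    rewrite [K1 * _]mulrDl addrAC lerD//.
      rewrite lerD//.
        by rewrite normrM ler_pM// HKm'.
      rewrite -!mulrA normrM ler_pM// ?HKm//.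
      by rewrite normrM ler_pM// HKs.
    by rewrite normrM ler_pM// HKm.
rewrite ge0_integralD//; last 4 first.
- by move=> x _; rewrite -EFinM lee_fin mulr_ge0.
- by apply: measurable_funeM; exact: m1.
- by move=> x _; rewrite -EFinM lee_fin mulr_ge0.
- by apply: measurable_funeM; exact: m2.
rewrite !ge0_integralZl//.
rewrite [leRHS](_ : _ = K1%:E * M1%:E + Km%:E * M2%:E)%E//.
apply: leeD; apply: lee_wpmul2l; rewrite ?lee_fin//.
- exact: HM1.
- exact: HM2.
Qed.

Let strip_density (p : R * R) : R :=
  let E := expR (- ((s \_ `[t0, t1]) p.1 * p.2)) in
  let U := ((fun q : R * R => u q.1 q.2) \_ quadrant) p in
  let V := ((fun q : R * R => partial_t u q.1 q.2) \_ quadrant) p in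
  (m' \_ `[t0, t1]) p.1 * (E * U) + (m \_ `[t0, t1]) p.1 * (E * V)
  - (m \_ `[t0, t1]) p.1 * (s' \_ `[t0, t1]) p.1 * (p.2 * (E * U)).

Let strip_densityE (p : R * R) : strip_density p =
  if (p.1 \in `[t0, t1]) && (0 < p.2) then
    characteristic_density m m' s p.1 p.2 else 0.
Proof.
rewrite /strip_density !patchE !mem_setE.
have -> : (point : R) = 0 by [].
case: (boolP (p.1 \in _)) => [tI|_] /=; last by rewrite !mul0r subr0 addr0.
have -> : (p \in quadrant) = (0 < p.2).
  apply/idP/idP => [|x0]; first by rewrite inE => -[].
  by rewrite inE; split => //; apply: time_gt0; move: tI; rewrite in_itv.
by case: ifP => // _; rewrite !mulr0 subr0 addr0.
Qed.

Let measurable_strip_density : measurable_fun setT strip_density.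
Proof.
have [_ cu _ _ _] := u_sol.
have mU := quadrant_continuous_measurable _ _ solution_continuous.
have mV := quadrant_continuous_measurable _ _
  (fun p Qp => let: And3 H _ _ := cu p Qp in H).
have mt (h : R -> R) : {within `[t0, t1], continuous h} ->
    measurable_fun setT (fun p : R * R => (h \_ `[t0, t1]) p.1).
  by move=> /segment_continuous_measurable mh; exact: measurableT_comp.
have ms := mt _ (within_of _ cs); have ms' := mt _ (within_of _ cs').
have mm := mt _ cm; have mm' := mt _ cm'.
have mE : measurable_fun setT
    (fun p : R * R => expR (- ((s \_ `[t0, t1]) p.1 * p.2))).
  apply: measurableT_comp => //; apply: measurableT_comp => //.
  exact: measurable_funM ms measurable_snd.
have mEU := measurable_funM mE mU.
have mEV := measurable_funM mE mV.
apply: measurable_funB.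
  exact: measurable_funD (measurable_funM mm' mEU) (measurable_funM mm mEV).
exact: measurable_funM (measurable_funM mm ms') (measurable_funM measurable_snd mEU).
Qed.

Let density_primitive (x : R) : 0 < x ->
  (\int[mu]_(t in `[t0, t1]) (characteristic_density m m' s t x)%:E =
   (m t1 * (expR (- (s t1 * x)) * u t1 x)
    - m t0 * (expR (- (s t0 * x)) * u t0 x))%:E)%E.
Proof.
move=> x0; have [du cu _ _ _] := u_sol.
pose EU t := expR (- (s t * x)) * u t x.
pose DU t := expR (- (s t * x)) * partial_t u t x - s' t * (x * EU t).
have dE t : t0 <= t <= t1 -> is_derive t 1 EU (DU t).
  move=> tI; have [dut _ _] := du t x (time_gt0 _ tI) x0.
  have H1 := derivable_is_derive1 dut; have H2 := ds _ tI.
  by rewrite /EU; derive_by; rewrite /DU /EU /s' /partial_t; ring.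
have cE t : t0 <= t <= t1 -> {for t, continuous EU}.
  by move=> /dE /is_derive_continuous.
have cD t : t0 <= t <= t1 -> {for t, continuous DU}.
  move=> tI; have tgt0 := time_gt0 _ tI.
  apply: cvgB; apply: cvgM.
  - have := is_derive_continuous (is_derive_fun_exp (is_derive_fun_opp
      (is_derive_fun_mul (ds _ tI) (is_derive_fun_cst x t)))).
    exact.
  - by apply: continuous_slice_t => // p /cu[].
  - exact: cs'.
  - by apply: cvgM; [exact: cvg_cst|exact: cE].
have wE := within_of _ cE; have wD := within_of _ cD.
have cdens : {within `[t0, t1], continuous (fun t => m' t * EU t + m t * DU t)}.
  move=> t; apply: cvgD; apply: cvgM; [exact: cm'|exact: wE|exact: cm|exact: wD].
have cprim : {within `[t0, t1], continuous (fun t => m t * EU t)}.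
  move=> t; apply: cvgM; [exact: cm|exact: wE].
have dprim t : t \in `]t0, t1[ ->
    is_derive t 1 (fun t => m t * EU t) (m' t * EU t + m t * DU t).
  rewrite in_itv /= => tI; apply: is_derive_fun_mul; first exact: dm.
  by apply: dE; case/andP: tI => ? ?; rewrite !ltW.
under eq_integral => t _.
  rewrite (_ : characteristic_density _ _ _ _ _ = m' t * EU t + m t * DU t); last first.
    by rewrite /characteristic_density /DU /EU /s'; ring.
  over.
rewrite (@continuous_FTC2 _ _ (fun t => m t * EU t) _ _ t01 cdens)//.
  have [? ? ?] := (continuous_within_itvP _ t01).1 cprim.
  by split => // t /dprim[].
by move=> t /dprim /is_derive1E.
Qed.

(** Both sides are the integral of [characteristic_density] over the strip. *)
Theorem characteristic_identity :
  mu.-integrable `[t0, t1] (EFin \o (fun t =>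
    m t * f t + (m' t - c * s t * m t) * laplace (u t) (s t))) /\
  \int[mu]_(t in `[t0, t1])
    (m t * f t + (m' t - c * s t * m t) * laplace (u t) (s t)) =
  m t1 * laplace (u t1) (s t1) - m t0 * laplace (u t0) (s t0).
Proof.
have [B HB] := density_bound.
have [iw ->] := strip_fubini _ _ _ (characteristic_density m m' s)
  (fun t x => m t * (expR (- (s t * x)) * u t x))
  (fun t => m t * f t + (m' t - c * s t * m t) * laplace (u t) (s t))
  _ t01 measurable_strip_density strip_densityE HB
  (fun t tI => (integral_characteristic_density m m' s t (time_gt0 _ tI) (s_gt0 _ tI)).2)
  density_primitive.
split => //.
have I t : t0 <= t <= t1 ->
    mu.-integrable `]0, +oo[ (EFin \o (fun x => expR (- (s t * x)) * u t x)).
  by move=> tI; apply: laplace_integrable_slice; [exact: time_gt0|exact: s_gt0].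
have I0 : t0 <= t0 <= t1 by rewrite lexx ltW.
have I1 : t0 <= t1 <= t1 by rewrite lexx ltW.
rewrite RintegralB//; last 2 first.
- exact: (integrableZl _ (m t1) (I _ I1)).
- exact: (integrableZl _ (m t0) (I _ I0)).
by rewrite !RintegralZl//; exact: I.
Qed.

End CharacteristicIdentity.

(** * The Gamma kernel *)

Section GammaKernel.
Context {R : realType}.
Notation mu := (@lebesgue_measure R).

Lemma positive_continuous_measurable (h : R -> R) :
  (forall x : R, 0 < x -> {for x, continuous h}) ->
  measurable_fun (`]0, +oo[ : set R) h.
Proof.
move=> ch; apply: open_continuous_measurable_fun; first exact: interval_open.
by move=> x; rewrite inE /= in_itv /= andbT; exact: ch.
Qed.

(** Monotone convergence along the intervals [[1/n, n]], on which the integral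
    is an increment of [F] and hence at most [2 B]. *)
Lemma bounded_primitive_integrable (F f : R -> R) (B : R) :
  (forall x : R, 0 < x -> is_derive x 1 F (f x)) ->
  (forall x : R, 0 < x -> {for x, continuous f}) ->
  (forall x, 0 < x -> 0 <= f x) -> (forall x, 0 < x -> `|F x| <= B) ->
  mu.-integrable `]0, +oo[ (EFin \o f).
Proof.
move=> dF cf f0 FB.
pose A (n : nat) := `[n.+2%:R^-1 : R, n.+2%:R]%classic.
have mf := positive_continuous_measurable _ cf.
have n0 (n : nat) : 0 < n.+2%:R :> R by rewrite ltr0n.
have AE : `]0%R, +oo[%classic = \bigcup_n A n.
  apply/seteqP; split => [x|x [n _]] /=; rewrite !in_itv /= andbT; last first.
    rewrite /A /= in_itv /= => /andP[+ _].
  by apply: lt_le_trans; rewrite invr_gt0.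
  move=> x0; pose n := Num.truncn (x + x^-1); exists n => //; rewrite /A /= in_itv /=.
  have H : x + x^-1 <= n.+2%:R.
    rewrite (le_trans (ltW (truncnS_gt _)))// ler_nat //.
  apply/andP; split; last by apply: le_trans H; rewrite lerDl invr_ge0 ltW.
  rewrite invf_ple ?posrE//; apply: le_trans H.
  by rewrite lerDr ltW.
have AI n : (\int[mu]_(x in A n) (f x)%:E <= (2 * B)%:E)%E.
  have nn : n.+2%:R^-1 < n.+2%:R :> R.
    by rewrite (@lt_trans _ _ 1)// ?ltr1n// invf_lt1// ltr1n.
  have dA (x : R) : n.+2%:R^-1 <= x <= n.+2%:R -> is_derive x 1 F (f x).
    by move=> /andP[+ _] => nx; apply: dF; apply: lt_le_trans nx; rewrite invr_gt0.
  have cA : {within `[n.+2%:R^-1, n.+2%:R], continuous f}.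
    apply: continuous_in_subspaceT => x; rewrite inE /= in_itv /= => /andP[nx _].
    by apply: cf; apply: lt_le_trans nx; rewrite invr_gt0.
  have := continuous_FTC2_closed _ F f _ _ nn dA cA.
  have iA : mu.-integrable (A n) (EFin \o f).
    by apply: continuous_compact_integrable => //; exact: segment_compact.
  have fin : (\int[mu]_(x in A n) (f x)%:E)%E \is a fin_num.
    by apply: integrable_fin_num => //; exact: measurable_itv.
  rewrite /Rintegral => E; rewrite -(fineK fin) E.
  rewrite lee_fin (le_trans (ler_norm _))// (le_trans (ler_normB _ _))//.
  by rewrite mulr2n mulrDl mul1r lerD// FB ?invr_gt0.
apply/integrableP; split; first exact/measurable_EFinP.
under eq_integral => x.
  rewrite inE /= in_itv /= andbT => x0.
  rewrite ger0_norm ?f0//.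
  over.
apply: (@le_lt_trans _ _ (2 * B)%:E); last exact: ltry.
rewrite AE.
have H : (\int[mu]_(x in A n) (f x)%:E)%E @[n --> \oo] -->
    (\int[mu]_(x in \bigcup_n A n) (f x)%:E)%E.
  apply: ge0_nondecreasing_set_cvg_integral.
  - move=> m n mn; apply/subsetPset; apply: subset_itv; rewrite bnd_simp.
      by rewrite lef_pV2 ?posrE// ler_nat.
    by rewrite ler_nat.
  - by move=> n; exact: measurable_itv.
  - move=> n; apply/measurable_EFinP; apply: measurable_funS mf => //.
    by rewrite AE; exact: bigcup_sup.
  - move=> n x; rewrite /A /= in_itv /= => /andP[nx _]; rewrite lee_fin f0//.
    by apply: lt_le_trans nx; rewrite invr_gt0.
rewrite -(cvg_lim _ H)//; apply: lime_le.
  by apply/cvg_ex; exists (\int[mu]_(x in \bigcup_n A n) (f x)%:E)%E.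
exact: nearW.
Qed.

(** [ln (x / p) <= x / p], multiplied by [p] and exponentiated. *)
Lemma powR_expR_le (p x : R) : 0 < p -> 0 < x -> x `^ p * expR (- x) <= p `^ p.
Proof.
move=> p0 x0; rewrite expRN ler_pdivrMr ?expR_gt0//.
have -> : x = p * (x / p) by field; rewrite gt_eqF.
have xp0 : 0 < x / p by rewrite divr_gt0.
rewrite powRM ?(ltW p0) ?(ltW xp0)// ler_wpM2l ?powR_ge0//.
rewrite /powR gt_eqF// ler_expR ler_wpM2l ?(ltW p0)//.
exact/ltW/ln_sublinear.
Qed.

(** The kernel is dominated near 0 and near infinity at once by a multiple of the
    derivative of the bounded function [x^q / (1 + x^q)], because
    [(1 + x^q)^2 exp(-x)] is bounded. *)
Lemma gamma_kernel_integrable (q : R) : 0 < q ->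
  mu.-integrable `]0, +oo[ (EFin \o (fun x => x `^ (q - 1) * expR (- x))).
Proof.
move=> q0.
pose F (x : R) := x `^ q * (1 + x `^ q)^-1.
pose f (x : R) := q * x `^ (q - 1) / (1 + x `^ q) ^+ 2.
have p0 (x : R) : 0 < 1 + x `^ q by rewrite ltr_pwDl// powR_ge0.
have iq : mu.-integrable `]0, +oo[ (EFin \o f).
  apply: (@bounded_primitive_integrable F f 1).
  - move=> x x0; have H := is_derive1_powR q x0.
    have H1 : is_derive x 1 (fun x => 1 + x `^ q) (q * x `^ (q - 1)).
      by derive_by; rewrite add0r.
    have H2 : is_derive x 1 (fun x => (1 + x `^ q)^-1)
        (- (q * x `^ (q - 1)) / (1 + x `^ q) ^+ 2).
      by apply: is_derive_fun_inv H1; rewrite gt_eqF.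
    rewrite /F; derive_by; rewrite /f; field.
    by rewrite gt_eqF.
  - move=> x x0; apply: cvgM.
      apply: cvgM; first exact: cvg_cst.
      exact: is_derive_continuous (is_derive1_powR _ x0).
    apply: cvgV; first by rewrite expf_neq0// gt_eqF.
    apply: cvgM; (apply: cvgD; [exact: cvg_cst|]);
      exact: is_derive_continuous (is_derive1_powR _ x0).
  - by move=> x x0; rewrite divr_ge0 ?mulr_ge0 ?powR_ge0 ?exprn_ge0// ltW.
  - move=> x x0; rewrite ger0_norm; last first.
      by rewrite divr_ge0 ?powR_ge0// ltW.
    by rewrite ler_pdivrMr// mul1r lerDr.
pose C := (1 + 2 * q `^ q + (2 * q) `^ (2 * q)) / q.
apply: le_integrable (integrableZl _ C iq) => //.
  apply/measurable_EFinP; apply: positive_continuous_measurable => x x0.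
  apply: cvgM; first exact: is_derive_continuous (is_derive1_powR _ x0).
  have : is_derive x 1 (fun x : R => expR (- x)) (- expR (- x)).
    by derive_by; rewrite mulrN1.
  exact: is_derive_continuous.
move=> x /=; rewrite in_itv /= andbT => x0.
rewrite lee_fin ger0_norm; last by rewrite mulr_ge0 ?powR_ge0 ?expR_ge0.
have f0 : 0 <= f x by rewrite divr_ge0 ?mulr_ge0 ?powR_ge0 ?exprn_ge0// ltW.
have C0 : 0 <= C by rewrite divr_ge0 ?addr_ge0 ?mulr_ge0 ?powR_ge0// ltW.
rewrite ger0_norm; last exact: mulr_ge0.
rewrite /C /f [leRHS](_ : _ = x `^ (q - 1) *
   ((1 + 2 * q `^ q + (2 * q) `^ (2 * q)) / (1 + x `^ q) ^+ 2)); last first.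
  by field; rewrite !gt_eqF.
rewrite ler_wpM2l ?powR_ge0// ler_pdivlMr ?exprn_gt0//.
have q20 : 0 < 2 * q by rewrite mulr_gt0.
have H1 := powR_expR_le _ _ q0 x0; have := powR_expR_le _ _ q20 x0.
rewrite -{1}[2]/(2%:R) mulrC [2 * q]mulrC powRrM powR_mulrn ?powR_ge0// => H2.
have H3 : expR (- x) <= 1 by rewrite -expR0 ler_expR oppr_le0 ltW.
nra.
Qed.
End GammaKernel.

Section ScaledGamma.
Context {R : realType}.
Notation mu := (@lebesgue_measure R).

Lemma integrable_itv_obnd_cbnd (f : R -> R) (x : R) (y : itv_bound R) :
  mu.-integrable [set` Interval (BRight x) y] (EFin \o f) ->
  mu.-integrable [set` Interval (BLeft x) y] (EFin \o f).
Proof.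
move=> /integrableP[mf intf]; apply/integrableP; split.
  exact/emeasurable_fun_itv_obnd_cbndP.
by rewrite -integral_itv_obnd_cbnd//; exact: measurableT_comp.
Qed.

Lemma primitive_from_0 (f : R -> R) :
  (forall M : R, mu.-integrable `[0, M] (EFin \o f)) ->
  (forall x : R, 0 < x -> {for x, continuous f}) ->
  (forall M : R, 0 < M -> {within `[0, M],
    continuous (fun x : R => \int[mu]_(r in `[0, x]) f r)}) /\
  (forall x : R, 0 < x ->
    is_derive x 1 (fun x : R => \int[mu]_(r in `[0, x]) f r) (f x)).
Proof.
move=> intf cf; split => [M M0|x x0].
  by apply: parameterized_integral_continuous => //; exact: ltW.
have xx1 : x < x + 1 by rewrite ltrDl.
have [d1 d2] := continuous_FTC1_closed xx1 (intf _) x0 (cf _ x0).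
by apply: DeriveDef; [exact: d1|rewrite -derive1E; exact: d2].
Qed.

Lemma within_continuous_from_0 (h : R -> R) (M : R) : 0 < M ->
  (forall x : R, 0 < x -> {for x, continuous h}) -> h x @[x --> 0^'+] --> h 0 ->
  {within `[0, M], continuous h}.
Proof.
move=> M0 ch h0; apply/continuous_within_itvP => //; split => //.
  by move=> x; rewrite in_itv /= => /andP[x0 _]; exact: ch.
by apply: cvg_at_left_filter; exact: ch.
Qed.

Lemma continuous_powR_expR (b q x : R) : 0 < x ->
  {for x, continuous (fun r : R => r `^ (q - 1) * expR (- (b * r)))}.
Proof.
move=> x0; apply: cvgM; first exact: is_derive_continuous (is_derive1_powR _ x0).
have : is_derive x 1 (fun x : R => expR (- (b * x))) (- b * expR (- (b * x))).
  by derive_by; ring.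
exact: is_derive_continuous.
Qed.

(** On a bounded interval the kernels with different [b] differ by a bounded
    factor. *)
Lemma powR_expR_integrable (b q M : R) : 0 < q ->
  mu.-integrable `[0, M] (EFin \o (fun r => r `^ (q - 1) * expR (- (b * r)))).
Proof.
move=> q0; apply: integrable_itv_obnd_cbnd.
have sub : `]0, M] `<=` (`]0%R, +oo[ : set R) by apply: subset_itvl; rewrite bnd_simp.
have ig : mu.-integrable `]0, M] (EFin \o (fun r => r `^ (q - 1) * expR (- r))).
  by apply: integrableS (gamma_kernel_integrable _ q0).
apply: le_integrable (integrableZl _ (expR (`|1 - b| * M)) ig) => //.
  apply/measurable_EFinP; apply: measurable_funS (positive_continuous_measurable _ _) => // x x0.
  exact: continuous_powR_expR.
move=> x; rewrite /= in_itv /= => /andP[x0 xM].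
rewrite lee_fin ger0_norm; last by rewrite mulr_ge0 ?powR_ge0 ?expR_ge0.
rewrite ger0_norm; last by rewrite !mulr_ge0 ?powR_ge0 ?expR_ge0.
rewrite mulrCA ler_wpM2l ?powR_ge0// -expRD ler_expR.
have : (1 - b) * x <= `|1 - b| * M.
  by rewrite (le_trans (ler_wpM2r (ltW x0) (ler_norm _)))// ler_wpM2l.
lra.
Qed.

Lemma upper_GammaE (q p : R) : 0 < q -> 0 <= p ->
  upper_Gamma q p = upper_Gamma q 0 -
    \int[mu]_(x in `[0, p]) (x `^ (q - 1) * expR (- x)).
Proof.
move=> q0 p0; pose h (x : R) := x `^ (q - 1) * expR (- x).
have ih : mu.-integrable `[0, +oo[ (EFin \o h).
  by apply: integrable_itv_obnd_cbnd; exact: gamma_kernel_integrable.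
rewrite /upper_Gamma Rintegral_itvB ?bnd_simp// Rintegral_itv_obnd_cbnd//.
by apply: integrableS ih => //; apply: subset_itv; rewrite bnd_simp.
Qed.

Lemma scaled_Gamma_pos (b v : R) : 0 < b -> scaled_Gamma b v =
  fun x => b `^ (- (2 * v)) * upper_Gamma (2 * v) (b * x).
Proof. by move=> b0; apply/funext => x; rewrite /scaled_Gamma b0. Qed.

Lemma scaled_Gamma_nonpos (b v : R) : b <= 0 -> scaled_Gamma b v =
  fun x => - \int[mu]_(r in `[0, x]) (r `^ (2 * v - 1) * expR (- (b * r))).
Proof. by move=> b0; apply/funext => x; rewrite /scaled_Gamma ltNge b0. Qed.

(** For [b > 0] the substitution [x = b r] in the incomplete Gamma function
    produces [b (b r)^(2v-1) = b^(2v) r^(2v-1)]. *)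
Lemma scaled_Gamma_derive (b v x : R) : 0 < v -> 0 < x ->
  is_derive x 1 (scaled_Gamma b v) (- (x `^ (2 * v - 1) * expR (- (b * x)))).
Proof.
move=> v0 x0; have q0 : 0 < 2 * v by rewrite mulr_gt0.
case: (ltP 0 b) => [b0|b0]; last first.
  rewrite scaled_Gamma_nonpos//; apply: is_derive_fun_opp.
  have [_ H] := primitive_from_0 _ (fun M => powR_expR_integrable b _ M q0)
    (fun x => continuous_powR_expR b (2 * v) x).
  exact: H.
have iP M : mu.-integrable `[0, M] (EFin \o (fun r => r `^ (2 * v - 1) * expR (- r))).
  apply: eq_integrable (powR_expR_integrable 1 _ M q0) => // z _.
  by rewrite /= mul1r.
have cP y (y0 : 0 < y) : {for y, continuous (fun r : R => r `^ (2 * v - 1) * expR (- r))}.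
  have := continuous_powR_expR 1 (2 * v) y y0.
  by under [X in {for _, continuous X} -> _]eq_fun do rewrite mul1r.
have [_ H] := primitive_from_0 _ iP cP.
have bx0 : 0 < b * x by rewrite mulr_gt0.
have Hbx := H _ bx0.
have Hb : is_derive x 1 (fun x => b * x) b by derive_by; ring.
have Hc := is_derive_fun_comp Hbx Hb.
have Hd : is_derive x 1 (fun mu => b `^ (- (2 * v)) * (upper_Gamma (2 * v) 0 -
     \int[lebesgue_measure]_(x in `[0, b * mu]) (x `^ (2 * v - 1) * expR (- x))))
   (- (x `^ (2 * v - 1) * expR (- (b * x)))).
  derive_by.
  have bE : b `^ (2 * v - 1) = b `^ (2 * v) / b.
    by rewrite powRB ?powRr1 ?(ltW b0)// (gt_eqF b0) implybT.
  rewrite powRM ?(ltW b0) ?(ltW x0)// powRN bE; field.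
  by rewrite !gt_eqF// powR_gt0.
rewrite scaled_Gamma_pos//; apply: near_eq_is_derive Hd; near=> z.
have z0 : 0 < z by near: z; exact: lt_nbhsr.
by rewrite -upper_GammaE// mulr_ge0// ltW.
Unshelve. all: by end_near. Qed.

Lemma scaled_Gamma_cvg0 (b v : R) : 0 < v ->
  scaled_Gamma b v x @[x --> 0^'+] --> scaled_Gamma b v 0.
Proof.
move=> v0; have q0 : 0 < 2 * v by rewrite mulr_gt0.
pose P (k y : R) := \int[mu]_(r in `[0, y]) (r `^ (2 * v - 1) * expR (- (k * r))).
have P0 k : P k x @[x --> 0^'+] --> (0 : R).
  have [H _] := primitive_from_0 _ (fun M => powR_expR_integrable k _ M q0)
    (fun x => continuous_powR_expR k (2 * v) x).
  have [_ + _] := (continuous_within_itvP _ ltr01).1 (H _ ltr01).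
  by rewrite set_itv1 Rintegral_set1.
case: (ltP 0 b) => [b0|b0]; last first.
  rewrite scaled_Gamma_nonpos// set_itv1 Rintegral_set1.
  by apply: cvgN; exact: P0.
rewrite scaled_Gamma_pos// mulr0.
apply: cvgM; first exact: cvg_cst.
apply/cvg_at_rightP => w [w0 wl].
rewrite -[X in _ --> X]subr0.
have E n : upper_Gamma (2 * v) (b * w n) = upper_Gamma (2 * v) 0 - P 1 (b * w n).
  have bw0 : 0 <= b * w n by rewrite mulr_ge0 ?(ltW b0)// ltW.
  rewrite (upper_GammaE _ _ q0 bw0).
  by rewrite /P; congr (_ - _); apply: eq_Rintegral => x _; rewrite mul1r.
under eq_fun do rewrite E.
apply: cvgB; first exact: cvg_cst.
move/cvg_at_rightP : (P0 1); apply; split.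
  by move=> n; rewrite mulr_gt0.
by rewrite -(mulr0 b); apply: cvgM => //; exact: cvg_cst.
Qed.

Lemma scaled_Gamma_continuous (b v M : R) : 0 < v -> 0 < M ->
  {within `[0, M], continuous (scaled_Gamma b v)}.
Proof.
move=> v0 M0; apply: within_continuous_from_0 => //; last exact: scaled_Gamma_cvg0.
by move=> x x0; exact: is_derive_continuous (scaled_Gamma_derive b v x v0 x0).
Qed.

End ScaledGamma.

(** * Characteristics *)

Lemma within_continuousV (R : realType) (h : R -> R) (x y : R) : x < y ->
  {within `[x, y], continuous h} -> (forall z, x <= z <= y -> h z != 0) ->
  {within `[x, y], continuous (fun z => (h z)^-1)}.
Proof.
move=> xy /(continuous_within_itvP _ xy)[ch hx hy] h0.
have hx0 : h x != 0 by rewrite h0// lexx ltW.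
have hy0 : h y != 0 by rewrite h0// lexx ltW.
apply/(continuous_within_itvP _ xy); split; [|exact: cvgV|exact: cvgV].
move=> z zxy; apply: cvgV; last exact: ch.
by apply: h0; move: zxy; rewrite in_itv /= => /andP[? ?]; rewrite !ltW.
Qed.

Section Denominator.
Context {R : realType}.
Notation mu := (@lebesgue_measure R).
Context (a b c v : R) (a_gt0 : 0 < a) (v_gt0 : 0 < v).
Local Notation den := (G_denominator a b v).
Local Notation SG := (scaled_Gamma b v).

Lemma G_denominatorE (C t : R) : den C t = expR (b * t) * (C + a * SG t).
Proof. by rewrite /G_denominator; ring. Qed.

Lemma G_denominator_derive (C t : R) : 0 < t ->
  is_derive t 1 (den C) (b * den C t - a * t `^ (2 * v - 1)).
Proof.
move=> t0; have H := scaled_Gamma_derive b v t v_gt0 t0.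
rewrite /G_denominator; derive_by.
have : expR (b * t) * expR (- (b * t)) = 1 by rewrite -expRD subrr expR0.
move: (expR (b * t)) (expR (- (b * t))) => e e' ee.
rewrite (_ : a * t `^ (2 * v - 1) = a * t `^ (2 * v - 1) * (e * e')).
  by ring.
by rewrite ee mulr1.
Qed.

Lemma G_denominator_continuous (C M : R) : 0 < M ->
  {within `[0, M], continuous (den C)}.
Proof.
move=> M0; apply: within_continuous_from_0 => //.
  by move=> x x0; exact: is_derive_continuous (G_denominator_derive C x x0).
have ce : expR (b * x) @[x --> 0^'+] --> expR (b * 0).
  apply: cvg_at_right_filter.
  have : is_derive (0 : R) 1 (fun x => expR (b * x)) (expR (b * 0) * b).
    by derive_by; ring.
  by move/is_derive_continuous.
apply: cvgD; apply: cvgM => //; last exact: cvg_cst.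
by apply: cvgM; [exact: cvg_cst|exact: scaled_Gamma_cvg0].
Qed.

Lemma scaled_Gamma_antitone (s t : R) : 0 <= s -> s <= t -> SG t <= SG s.
Proof.
move=> s0; rewrite le_eqVlt => /predU1P[->//|st].
have t0 : 0 < t by exact: le_lt_trans st.
have dSG x : x \in `]s, t[ -> is_derive x 1 SG (- (x `^ (2 * v - 1) * expR (- (b * x)))).
  rewrite in_itv /= => /andP[sx _]; apply: scaled_Gamma_derive => //.
  exact: le_lt_trans sx.
have cSG : {within `[s, t], continuous SG}.
  apply: continuous_subspaceW (scaled_Gamma_continuous b v t v_gt0 t0).
  by apply: subset_itvr; rewrite bnd_simp.
have [x _ E] := MVT st dSG cSG.
rewrite -subr_le0 E mulNr oppr_le0 mulr_ge0 ?subr_ge0 ?(ltW st)//.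
by rewrite mulr_ge0 ?powR_ge0 ?expR_ge0.
Qed.

(** [exp(- b t) den C t = C + a SG t] decreases with [t]. *)
Lemma G_denominator_gt0 (C s t : R) : 0 <= s -> s <= t ->
  0 < den C t -> 0 < den C s.
Proof.
move=> s0 st; rewrite !G_denominatorE !pmulr_rgt0 ?expR_gt0// => /lt_le_trans; apply.
by rewrite lerD2l ler_pM2l// scaled_Gamma_antitone.
Qed.

Lemma indefinite_integral_exists : exists G, is_indefinite_integral a b c v G.
Proof.
exists (fun t C => \int[mu]_(r in `[0, t]) (c / den C r)) => C M M0 denN0.
have cV := within_continuousV _ _ _ _ M0 (G_denominator_continuous C M M0) denN0.
have ci : {within `[0, M], continuous (fun r => c / den C r)}.
  by move=> x; apply: cvgM; [exact: cvg_cst|exact: cV].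
have ii : mu.-integrable `[0, M] (EFin \o (fun r => c / den C r)).
  by apply: continuous_compact_integrable => //; exact: segment_compact.
split; first by apply: parameterized_integral_continuous => //; exact: ltW.
move=> t /andP[t0 tM].
have ct : {for t, continuous (fun r => c / den C r)}.
  apply: cvgM; first exact: cvg_cst.
  apply: cvgV; first by rewrite denN0// !ltW.
  exact: is_derive_continuous (G_denominator_derive C t t0).
have [d1 d2] := continuous_FTC1_closed tM ii t0 ct.
by apply: DeriveDef; [exact: d1|rewrite -derive1E; exact: d2].
Qed.

(** The curves [s(t)] along which the transformed equation becomes an ordinary
    one; their reciprocals solve the linear equation
    [p' = b p - a t^(2v-1)]. *)
Definition characteristic (C t : R) : R := (den C t)^-1.

Lemma characteristic_derive (C t : R) : 0 < t -> 0 < den C t ->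
  is_derive t 1 (characteristic C)
    (a * t `^ (2 * v - 1) * characteristic C t ^+ 2 - b * characteristic C t).
Proof.
move=> t0 den0; have H := G_denominator_derive C t t0.
apply: is_derive_eq; first by apply: is_derive_fun_inv H; rewrite gt_eqF.
by rewrite /characteristic; field; rewrite gt_eqF.
Qed.

(** [K t s] is the parameter of the characteristic through [(t, s)]. *)
Lemma G_denominator_K (t s : R) : 0 < s -> den (K a b v t s) t = s^-1.
Proof.
move=> s0; rewrite G_denominatorE /K; field.
by rewrite !gt_eqF ?expR_gt0.
Qed.

End Denominator.

(** * The initial value along a characteristic *)

Lemma laplace_continuous (R : realType) (h : R -> R) (s : R) :
  laplace_integrable h -> 0 < s -> {for s, continuous (laplace h)}.
Proof.
move=> ih s0; have s2 : 0 < s / 2 by rewrite divr_gt0.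
pose g (r x : R) : R := expR (- (r * x)) * h x.
have := @continuity_under_integral R _ _ (@lebesgue_measure R) g `]0, +oo[
  (measurable_itv _) (s / 2) (2 * s) _ _ (fun x => `|g (s / 2) x|) _ _ s.
apply.
- move=> r; rewrite /= in_itv /= => /andP[sr _].
  by apply: ih; exact: lt_trans sr.
- apply/aeW => x _ r _; apply: cvgM; last exact: cvg_cst.
  have : is_derive r 1 (fun r : R => expR (- (r * x))) (- x * expR (- (r * x))).
    by derive_by; ring.
  exact: is_derive_continuous.
- exact: integrable_norm (ih _ s2).
- move=> r; rewrite /= in_itv /= => /andP[sr _]; apply/aeW => x.
  rewrite /= in_itv /= andbT => x0.
  rewrite /g !normrM ler_wpM2r// !(ger0_norm (expR_ge0 _)) ler_expR lerN2.
  by rewrite ler_wpM2r// ltW.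
- by rewrite inE /= in_itv /=; apply/andP; split; lra.
Qed.

Lemma laplace_norm_le (R : realType) (h : R -> R) (r s M : R) :
  laplace_integrable h -> 0 < r -> r <= s ->
  (\int[@lebesgue_measure R]_(x in `]0%R, +oo[)
     `|expR (- (r * x)) * h x|%:E <= M%:E)%E -> `|laplace h s| <= M.
Proof.
move=> ih r0 rs hM; have s0 : 0 < s by exact: lt_le_trans rs.
rewrite -lee_fin; apply: le_trans hM.
rewrite /laplace EFin_normr_Rintegral//; last exact: ih.
apply: le_trans (le_abse_integral _ _ _) _ => //.
  exact: measurable_int (ih _ s0).
apply: ge0_le_integral => //.
- exact: measurable_int (integrable_abse (ih _ s0)).
- exact: measurable_int (integrable_abse (ih _ r0)).
- move=> x; rewrite /= in_itv /= andbT => x0.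
  rewrite lee_fin !normrM ler_wpM2r// !(ger0_norm (expR_ge0 _)) ler_expR lerN2.
  by rewrite ler_wpM2r// ltW.
Qed.

(** The supremum [S] of [h] over [[t, T]] is finite and bounded by the larger
    of a constant and [B + S / 2]; this bounds [S] independently of [t]. *)
Lemma absorb_half (R : realType) (h : R -> R) (T t1 B : R) :
  0 < t1 -> t1 <= T ->
  (forall e, 0 < e -> exists M, forall t, e <= t <= T -> h t <= M) ->
  (forall e M, 0 < e -> e < t1 -> (forall t, e <= t <= T -> h t <= M) ->
     h e <= B + M / 2) ->
  exists M, forall t, 0 < t <= T -> h t <= M.
Proof.
move=> t10 t1T hloc hstep; have [N HN] := hloc t1 t10.
exists (Num.max N (2 * B)) => t /andP[t0 tT].
have [M HM] := hloc t t0.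
pose A := h @` `[t, T].
have ubA : has_ubound A.
  by exists M => _ [r + <-]; rewrite /= in_itv /=; exact: HM.
have At : A (h t) by exists t => //=; rewrite in_itv /= lexx.
have leS r : t <= r <= T -> h r <= sup A.
  by move=> rI; apply: ub_le_sup => //; exists r => //=; rewrite in_itv.
have : sup A <= Num.max N (B + sup A / 2).
  apply: ge_sup; first by exists (h t).
  move=> _ [r + <-]; rewrite /= in_itv /= => /andP[tr rT].
  rewrite le_max; case: (leP t1 r) => [t1r|rt1]; first by rewrite HN ?t1r.
  apply/orP; right; apply: hstep => //; first exact: lt_le_trans tr.
  by move=> z /andP[rz zT]; apply: leS; rewrite (le_trans tr).
rewrite le_max => H; apply: le_trans (leS t _) _; first by rewrite lexx.
rewrite le_max; case/orP: H => [->//|H].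
by apply/orP; right; lra.
Qed.

Lemma near_right_itv (R : realType) (P : R -> Prop) (T : R) : 0 < T ->
  (\forall e \near 0^'+, P e) ->
  exists2 t1 : R, 0 < t1 <= T & forall e, 0 < e -> e < t1 -> P e.
Proof.
move=> T0 [d /= d0 dP]; exists (Num.min d T); first by rewrite lt_min d0 T0 ge_min lexx orbT.
move=> e e0; rewrite lt_min => /andP[ed _]; apply: dP => //=.
by rewrite sub0r normrN gtr0_norm.
Qed.

Lemma Rintegral_norm_le (R : realType) (h : R -> R) (x y B : R) : x <= y ->
  (@lebesgue_measure R).-integrable `[x, y] (EFin \o h) ->
  (forall z, x <= z <= y -> `|h z| <= B) ->
  `|\int[@lebesgue_measure R]_(z in `[x, y]) h z| <= B * (y - x).
Proof.
move=> xy ih hB; apply: le_trans (le_normr_Rintegral _ ih) _ => //.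
have fin : (@lebesgue_measure R `[x, y] < +oo)%E.
  by rewrite lebesgue_measure_itv /=; case: ifP => _; rewrite ltry.
apply: (@le_trans _ _ (\int[@lebesgue_measure R]_(z in `[x, y]) cst B z)).
  apply: le_Rintegral => //.
  - exact: integrable_norm.
  - apply: continuous_compact_integrable; first exact: segment_compact.
    by apply: continuous_subspaceT => z; exact: cvg_cst.
rewrite Rintegral_cst//; have -> : fine (@lebesgue_measure R `[x, y]) = y - x.
  rewrite lebesgue_measure_itv /= lte_fin.
  by case: ltP => //= yx; rewrite (@le_anti _ _ x y) ?subrr// xy yx.
by [].
Qed.


Section InitialLimit.
Context {R : realType}.
Notation mu := (@lebesgue_measure R).
Context (a b c v xi : R) (u : R -> R -> R) (f : R -> R) (G : R -> R -> R).
Context (a_gt0 : 0 < a) (v_gt0 : 0 < v)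
  (u_sol : is_solution a b c v u) (f_flux : is_flux a b c v u f)
  (G_int : is_indefinite_integral a b c v G).
Local Notation den := (G_denominator a b v).
Local Notation chi := (characteristic a b v).
Local Notation SG := (scaled_Gamma b v).

Definition transform_along (C t : R) : R := laplace (u t) (chi C t).
Local Notation W := transform_along.
(* conversion must not unfold the integrals *)
Opaque transform_along.

Lemma characteristic_gt0 (C t T : R) : 0 <= t -> t <= T -> 0 < den C T -> 0 < chi C t.
Proof.
by move=> t0 tT dT; rewrite invr_gt0; exact: G_denominator_gt0 dT.
Qed.

(** The weight [exp(G)] of the characteristic [C], used along the characteristic
    [C']; for [C = C'] the terms with [W] cancel. *)
Lemma weighted_identity (C C' t0 T : R) : 0 < t0 -> t0 < T ->
  0 < den C T -> 0 < den C' T ->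
  mu.-integrable `[t0, T] (EFin \o (fun t => expR (G t C) * f t +
    c * (chi C t - chi C' t) * expR (G t C) * W C' t)) /\
  \int[mu]_(t in `[t0, T]) (expR (G t C) * f t +
    c * (chi C t - chi C' t) * expR (G t C) * W C' t) =
  expR (G T C) * W C' T - expR (G t0 C) * W C' t0.
Proof.
move=> t00 t0T dC dC'.
have T0 : 0 < T by exact: lt_trans t0T.
have den0 t : 0 <= t <= T -> den C t != 0.
  by move=> /andP[t1 tT]; rewrite gt_eqF//; exact: G_denominator_gt0 dC.
have [cG dG] := G_int C T T0 den0.
have sub : `[t0, T] `<=` (`[0, T] : set R) by apply: subset_itvr; rewrite bnd_simp ltW.
have cm0 : {within `[0, T], continuous (fun t => expR (G t C))}.
  move=> t; apply: (@cvg_comp _ _ _ (fun t => G t C) expR); first exact: cG.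
  exact: continuous_expR.
have cm := continuous_subspaceW sub cm0.
have cV := continuous_subspaceW sub (within_continuousV _ _ _ _ T0
  (G_denominator_continuous a b v v_gt0 C T T0) den0).
pose m' t := c * chi C t * expR (G t C).
have cm' : {within `[t0, T], continuous m'}.
  move=> t; apply: cvgM; last exact: cm.
  by apply: cvgM; [exact: cvg_cst|exact: cV].
have dm t : t0 < t < T -> is_derive t 1 (fun t => expR (G t C)) (m' t).
  move=> /andP[tt tT]; have H : is_derive t 1 (fun r => G r C) (c / den C t).
    by apply: dG; rewrite tT (lt_trans t00).
  by derive_by; rewrite /m' /characteristic mulrC.
have s0 t : t0 <= t <= T -> 0 < chi C' t.
  move=> /andP[tt tT]; apply: (characteristic_gt0 C' t T) => //.
  by rewrite (le_trans _ tt)// ltW.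
have ds t : t0 <= t <= T -> is_derive t 1 (chi C')
    (a * t `^ (2 * v - 1) * chi C' t ^+ 2 - b * chi C' t).
  move=> /andP[tt tT]; have tgt0 : 0 < t by exact: lt_le_trans tt.
  apply: characteristic_derive => //.
  by apply: (G_denominator_gt0 _ _ _ _ _ C' t T) => //; exact: ltW.
have E t : expR (G t C) * f t + (m' t - c * chi C' t * expR (G t C)) * W C' t =
   expR (G t C) * f t + c * (chi C t - chi C' t) * expR (G t C) * W C' t.
  by rewrite /m'; ring.
have [I1 I2] := characteristic_identity a b c v u f a_gt0 u_sol f_flux t0 T
  (fun t => expR (G t C)) m' (chi C') t00 t0T cm cm' dm s0 ds.
split; first by apply: eq_integrable I1 => // t _; rewrite /= E.
by rewrite -I2; apply: eq_Rintegral => t _; rewrite E.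
Qed.

Lemma characteristicE (C t : R) : chi C t = expR (- (b * t)) / (C + a * SG t).
Proof. by rewrite /characteristic G_denominatorE invfM expRN. Qed.

Let expb_le (t T : R) : 0 <= t -> t <= T -> expR (- (b * t)) <= expR (`|b| * T).
Proof.
move=> t0 tT; rewrite ler_expR -mulNr (le_trans (ler_norm _))// normrM normrN.
by rewrite ler_pM// ger0_norm.
Qed.

Let shift_ge (C d t T : R) : 0 <= t -> t <= T -> d <= C + a * SG T ->
  d <= C + a * SG t.
Proof.
move=> t0 tT /le_trans; apply; rewrite lerD2l ler_pM2l//.
exact: scaled_Gamma_antitone.
Qed.

Lemma characteristic_le (C d t T : R) : 0 <= t -> t <= T -> 0 < d ->
  d <= C + a * SG T -> 0 < chi C t <= expR (`|b| * T) / d.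
Proof.
move=> t0 tT d0 dC; have dCt := shift_ge _ _ _ _ t0 tT dC.
have Ct0 : 0 < C + a * SG t by exact: lt_le_trans dCt.
rewrite characteristicE divr_gt0 ?expR_gt0//=.
rewrite ler_pM ?expR_ge0 ?invr_ge0 ?(ltW Ct0)//; first exact: expb_le.
by rewrite lef_pV2.
Qed.

Lemma characteristic_dist (C C' d t T : R) : 0 <= t -> t <= T -> 0 < d ->
  d <= C + a * SG T -> d <= C' + a * SG T ->
  `|chi C t - chi C' t| <= expR (`|b| * T) / d ^+ 2 * `|C' - C|.
Proof.
move=> t0 tT d0 dC dC'.
have dCt := shift_ge _ _ _ _ t0 tT dC; have dCt' := shift_ge _ _ _ _ t0 tT dC'.
have Ct0 : 0 < C + a * SG t by exact: lt_le_trans dCt.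
have Ct0' : 0 < C' + a * SG t by exact: lt_le_trans dCt'.
rewrite !characteristicE (_ : _ - _ = expR (- (b * t)) *
    ((C + a * SG t) * (C' + a * SG t))^-1 * (C' - C)); last first.
  by field; rewrite !gt_eqF.
rewrite normrM ler_wpM2r// ger0_norm; last first.
  by rewrite mulr_ge0 ?expR_ge0// invr_ge0 ltW// mulr_gt0.
rewrite ler_pM ?expR_ge0//.
- by rewrite invr_ge0 ltW// mulr_gt0.
- exact: expb_le.
- by rewrite lef_pV2 ?posrE ?exprn_gt0 ?mulr_gt0// expr2 ler_pM ?(ltW d0).
Qed.

(** Take [weighted_identity] with the weight of [C] along both characteristics:
    the flux cancels in the difference.  The exponential factor bounds the
    ratio of two values of the weight, by the mean value theorem for [G]. *)
Lemma characteristic_comparison (C C' d t0 T M : R) : 0 < t0 -> t0 < T -> 0 < d ->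
  d <= C + a * SG T -> d <= C' + a * SG T -> 0 <= M ->
  (forall t, t0 <= t <= T -> `|W C' t| <= M) ->
  `|W C' t0 - W C t0| <= expR (`|c| * (expR (`|b| * T) / d) * T) *
     (`|W C' T - W C T| +
      `|c| * (expR (`|b| * T) / d ^+ 2 * `|C' - C|) * M * T).
Proof.
move=> t00 t0T d0 dC dC' M0 WM.
have T0 : 0 < T by exact: lt_trans t0T.
have den0 (C0 : R) : d <= C0 + a * SG T -> 0 < den C0 T.
  by move=> dC0; rewrite G_denominatorE mulr_gt0 ?expR_gt0// (lt_le_trans d0).
set S := expR (`|b| * T) / d; set L := `|c| * S * T.
set k := expR (`|b| * T) / d ^+ 2 * `|C' - C|.
have k0 : 0 <= k by rewrite mulr_ge0// divr_ge0 ?expR_ge0 ?exprn_ge0// ltW.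
pose m t := expR (G t C).
have m0 t : 0 < m t by exact: expR_gt0.
have mL t : t0 <= t <= T -> m t <= m t0 * expR L.
  move=> /andP[tt tT]; rewrite -expRD ler_expR -lerBlDl.
  have denn0 r : 0 <= r <= T -> den C r != 0.
    by move=> /andP[r0 rT]; rewrite gt_eqF//; apply: G_denominator_gt0 (den0 _ dC).
  have [cG dG] := G_int C T T0 denn0.
  have cG' : {within `[t0, t], continuous (fun r => G r C)}.
    by apply: continuous_subspaceW cG; apply: subset_itv; rewrite bnd_simp// ltW.
  have dG' r : r \in `]t0, t[ -> is_derive r 1 (fun r => G r C) (c / den C r).
    rewrite in_itv /= => /andP[r1 r2]; apply: dG.
    by rewrite (lt_trans t00 r1) (lt_le_trans r2 tT).
  have [r + ->] := MVT_segment tt dG' cG'.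
  rewrite in_itv /= => /andP[r1 r2].
  have tt0 : 0 <= t - t0 by rewrite subr_ge0.
  apply: le_trans (ler_norm _) _; rewrite normrM (ger0_norm tt0).
  have [r0 rT] : 0 <= r /\ r <= T.
    by split; [apply: le_trans r1; exact: ltW|exact: le_trans tT].
  have /andP[chi0 chiS] := characteristic_le C d r T r0 rT d0 dC.
  rewrite /L ler_pM//; last by rewrite lerBlDr (le_trans tT)// lerDl ltW.
  by rewrite normrM ler_wpM2l// -/(chi C r) ger0_norm// ltW.
have [I1 I2] := weighted_identity C C t0 T t00 t0T (den0 _ dC) (den0 _ dC).
have [I1' I2'] := weighted_identity C C' t0 T t00 t0T (den0 _ dC) (den0 _ dC').
pose h t := c * (chi C t - chi C' t) * m t * W C' t.
have ih : mu.-integrable `[t0, T] (EFin \o h).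
  apply: eq_integrable (integrableB _ I1' I1) => // t _.
  by rewrite /= -EFinB; congr EFin; rewrite /h /m; ring.
have E : \int[mu]_(t in `[t0, T]) h t =
    m T * (W C' T - W C T) - m t0 * (W C' t0 - W C t0).
  transitivity ((m T * W C' T - m t0 * W C' t0) - (m T * W C T - m t0 * W C t0)).
    rewrite -I2 -I2' -(RintegralB _ I1' I1)//; apply: eq_Rintegral => t _.
    by rewrite subrr mulr0 !mul0r addr0 [X in _ = X - _]addrC addrK.
  by rewrite !mulrBr; move: (m T * _) (m T * _) (m t0 * _) (m t0 * _) => *; ring.
have hB t : t0 <= t <= T -> `|h t| <= `|c| * k * (m t0 * expR L) * M.
  move=> tI; have /andP[tt tT] := tI.
  rewrite /h normrM ler_pM// ?WM// normrM ler_pM//; last first.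
    by rewrite gtr0_norm// mL.
  rewrite normrM ler_wpM2l//; apply: characteristic_dist => //.
  by rewrite (le_trans (ltW t00)).
have := Rintegral_norm_le _ _ _ _ _ (ltW t0T) ih hB; rewrite E => H.
rewrite -(ler_pM2l (m0 t0)) -[X in X * `|_|](gtr0_norm (m0 t0)) -normrM.
rewrite -[m t0 * _](subKr (m T * (W C' T - W C T))).
apply: le_trans (ler_normB _ _) _; rewrite [leRHS]mulrA [leRHS]mulrDr lerD//.
  by rewrite normrM gtr0_norm// ler_wpM2r// mL// lexx ltW.
apply: le_trans H _.
rewrite (_ : m t0 * expR L * _ = `|c| * k * (m t0 * expR L) * M * T); last by ring.
rewrite ler_wpM2l//; last by rewrite lerBlDr lerDl ltW.
have mt0 := ltW (m0 t0); rewrite mulr_ge0// mulr_ge0//; first exact: mulr_ge0.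
by rewrite mulr_ge0// expR_ge0.
Qed.


Lemma transform_along_bounded (C e T : R) : 0 < e -> 0 < den C T ->
  exists M, forall t, e <= t <= T -> `|W C t| <= M.
Proof.
move=> e0 dT; case: (ltP e T) => [eT|Te]; last first.
  exists `|W C T| => t /andP[et tT].
  by rewrite (_ : t = T)//; apply/le_anti; rewrite tT (le_trans Te).
have T0 : 0 < T by exact: lt_trans eT.
have chi0 t : e <= t <= T -> 0 < chi C t.
  by move=> /andP[et tT]; apply: characteristic_gt0 dT => //; exact: le_trans (ltW e0) et.
have cchi : {within `[e, T], continuous (chi C)}.
  apply: continuous_in_subspaceT => t; rewrite inE /= in_itv /= => /andP[et tT].
  have t0 : 0 < t by exact: lt_le_trans et.
  apply: is_derive_continuous; apply: characteristic_derive => //.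
  by apply: G_denominator_gt0 dT => //; exact: ltW.
have [r r0 Hr] := segment_continuous_positive _ _ _ _ (ltW eT) cchi chi0.
have [_ _ _ iu _] := u_sol.
have [M M0 HM] := laplace_uniform_bound _ _ r e T iu
  (solution_continuous a b c v u u_sol) r0 e0 (ltW eT).
exists M => t tI; apply: (laplace_norm_le _ _ r _ _ _ r0 (Hr _ tI) (HM _ tI)).
by apply: iu.1; case/andP: tI => + _; exact: lt_le_trans.
Qed.

(** The initial condition is known along the lines [s = const] only; the
    comparison with the characteristics [Ce e] carries it over to [C]. *)
Lemma transform_along_initial (C : R) : 0 < C + a * SG 0 ->
  (forall s : R, 0 < s ->
     laplace (u t) s @[t --> 0^'+] --> expR (- (s * xi))) ->
  W C t @[t --> 0^'+] --> expR (- (chi C 0 * xi)).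
Proof.
move=> D00 uinit; pose D0 := C + a * SG 0.
pose d := D0 / 2; have d0 : 0 < d by rewrite divr_gt0.
(* T is so small that C + a SG exceeds 3/4 of its initial value up to T *)
have SG0 : SG x @[x --> 0^'+] --> SG 0 by exact: scaled_Gamma_cvg0.
have [T [T0 dT]] : exists T : R, 0 < T /\ D0 * 3 / 4 <= C + a * SG T.
  have lim : C + a * SG x @[x --> 0^'+] --> D0.
    by apply: cvgD; [exact: cvg_cst|apply: cvgM => //; exact: cvg_cst].
  have D34 : D0 * 3 / 4 < D0 by rewrite -/D0 in D00; lra.
  near (0 : R)^'+ => T; exists T; split; first by near: T; exact: nbhs_right_gt.
  by apply: ltW; near: T; exact: cvgr_gt D34.
(* Ce e is the parameter of the characteristic through the point (e, chi C 0) *)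
pose Ce e := K a b v e (chi C 0).
have chi00 : 0 < chi C 0.
  by rewrite invr_gt0 G_denominatorE mulr_gt0 ?expR_gt0.
have WCe e : W (Ce e) e = laplace (u e) (chi C 0).
  by congr laplace; rewrite {1}/characteristic G_denominator_K ?invrK.
have Ce_lim : Ce e @[e --> 0^'+] --> C.
  have CeE e : Ce e = expR (- (b * e)) * (chi C 0)^-1 - a * SG e.
    rewrite /Ce /K expRN; field.
    by rewrite !gt_eqF ?expR_gt0.
  have lim : expR (- (b * e)) * (chi C 0)^-1 - a * SG e @[e --> 0^'+] -->
      1 * (chi C 0)^-1 - a * SG 0.
    apply: cvgB; apply: cvgM => //; try exact: cvg_cst.
    apply: cvg_at_right_filter.
    have : is_derive (0 : R) 1 (fun x => expR (- (b * x))) (- b).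
      by derive_by; rewrite mulr0 oppr0 expR0; ring.
    by move/is_derive_continuous; rewrite /prop_for /continuous_at mulr0 oppr0 expR0.
  rewrite (_ : Ce = fun e => expR (- (b * e)) * (chi C 0)^-1 - a * SG e); last exact/funext.
  have E0 : 1 * (chi C 0)^-1 - a * SG 0 = C.
    by rewrite /characteristic invrK G_denominatorE mulr0 expR0; ring.
  by rewrite E0 in lim.
have dTC : d <= C + a * SG T.
  by apply: le_trans dT; rewrite /d; rewrite -/D0 in D00; lra.
have Ced : \forall e \near 0^'+, d <= Ce e + a * SG T.
  have D4 : 0 < D0 / 4 by rewrite divr_gt0.
  move/cvgrPdist_le : Ce_lim => /(_ _ D4); apply: filterS => e He.
  by have := le_trans (ler_norm _) He; rewrite /d; rewrite -/D0 in dT; lra.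
pose l0 := expR (- (chi C 0 * xi)).
have ul0 : laplace (u e) (chi C 0) @[e --> 0^'+] --> l0 by exact: uinit.
have HB : \forall e \near 0^'+, `|laplace (u e) (chi C 0)| <= `|l0| + 1.
  move/cvgrPdist_le : ul0 => /(_ _ ltr01); apply: filterS => e He.
  rewrite -lerBlDl (le_trans _ He)// distrC.
  exact: lerB_dist.
have WT : W (Ce e) T @[e --> 0^'+] --> W C T.
  have [_ _ _ [iu _] _] := u_sol.
  have dCT : 0 < C + a * SG T by exact: lt_le_trans dTC.
  have chiT : 0 < chi C T by rewrite characteristicE divr_gt0 ?expR_gt0.
  have lchi : chi (Ce e) T @[e --> 0^'+] --> chi C T.
    rewrite characteristicE; under eq_fun do rewrite characteristicE.
    apply: cvgM; first exact: cvg_cst.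
    apply: cvgV; first by rewrite gt_eqF.
    by apply: cvgD => //; exact: cvg_cst.
  have Lc := laplace_continuous _ _ _ (iu T T0) chiT.
  exact: (cvg_comp _ _ lchi Lc).
pose S := expR (`|b| * T) / d.
pose E := expR (`|c| * S * T).
pose k := `|c| * (expR (`|b| * T) / d ^+ 2) * T.
have k0 : 0 <= k by rewrite !mulr_ge0 ?expR_ge0 ?invr_ge0 ?exprn_ge0// ltW.
have comp e M : 0 < e -> e < T -> d <= Ce e + a * SG T -> 0 <= M ->
    (forall t, e <= t <= T -> `|W C t| <= M) ->
    `|W C e - laplace (u e) (chi C 0)| <=
      E * (`|W C T - W (Ce e) T| + k * `|C - Ce e| * M).
  move=> e0 eT dCe M0 HM; rewrite -WCe.
  have := characteristic_comparison (Ce e) C d e T M e0 eT d0 dCe dTC M0 HM.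
  move/le_trans; apply; rewrite ler_wpM2l ?expR_ge0// lerD2l.
  by rewrite /k le_eqVlt; apply/orP; left; apply/eqP; ring.
have WT1 : \forall e \near 0^'+, `|W C T - W (Ce e) T| <= 1.
  by move/cvgrPdist_le : WT => /(_ _ ltr01).
have Ek : E * k * `|C - Ce e| @[e --> 0^'+] --> (0 : R).
  have : E * k * `|C - Ce e| @[e --> 0^'+] --> E * k * `|C - C|.
    apply: cvgM; first exact: cvg_cst.
    by apply: cvg_norm; apply: cvgB => //; exact: cvg_cst.
  by rewrite subrr normr0 mulr0.
have Ek2 : \forall e \near 0^'+, E * k * `|C - Ce e| <= 2^-1.
  have h0 : (0 : R) < 2^-1 by rewrite invr_gt0.
  by move/cvgr_le : Ek => /(_ _ h0).
(* for small e the comparison bounds |W C e| by a constant plus M / 2 *)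
have [M HM] : exists M, forall t, 0 < t <= T -> `|W C t| <= M.
  have [t1 /andP[t10 t1T] Ht1] := near_right_itv _ _ _ T0
    (filterI (filterI Ced HB) (filterI WT1 Ek2)).
  have dT0 : 0 < den C T.
    by rewrite G_denominatorE mulr_gt0 ?expR_gt0// (lt_le_trans d0).
  apply: (absorb_half _ _ T t1 (`|l0| + 1 + E) t10 t1T).
    by move=> e e0; exact: transform_along_bounded.
  move=> e M e0 et1 HM.
  have eT : e < T by exact: lt_le_trans t1T.
  have M0 : 0 <= M by apply: le_trans (HM e _) => //; rewrite lexx ltW.
  have [[dCe HBe] [WT1e Ek2e]] := Ht1 e e0 et1.
  have E0 : 0 <= E by exact: expR_ge0.
  have Dle : `|W C e - laplace (u e) (chi C 0)| <= E + M / 2.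
    apply: le_trans (comp e M e0 eT dCe M0 HM) _.
    rewrite mulrDr lerD//; first by rewrite ler_piMr.
    by rewrite 2!mulrA [leRHS]mulrC ler_wpM2r.
  have := lerB_dist (W C e) (laplace (u e) (chi C 0)).
  rewrite lerBlDl => /le_trans; apply; rewrite -[leRHS]addrA.
  exact: lerD.
have M0 : 0 <= M by apply: le_trans (HM T _) => //; rewrite T0 lexx.
have diff0 : W C e - laplace (u e) (chi C 0) @[e --> 0^'+] --> (0 : R).
  have WT0 : `|W C T - W (Ce e) T| @[e --> 0^'+] --> (0 : R).
    have H : `|W C T - W (Ce e) T| @[e --> 0^'+] --> `|W C T - W C T|.
      by apply: cvg_norm; apply: cvgB; [exact: cvg_cst|exact: WT].
    have E0 : `|W C T - W C T| = 0 by rewrite subrr normr0.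
    by rewrite E0 in H.
  have bnd0 : E * `|W C T - W (Ce e) T| + E * k * `|C - Ce e| * M @[e --> 0^'+] --> (0 : R).
    have H : E * `|W C T - W (Ce e) T| + E * k * `|C - Ce e| * M @[e --> 0^'+] --> E * 0 + 0 * M.
      apply: cvgD; apply: cvgM; [exact: cvg_cst|exact: WT0|exact: Ek|exact: cvg_cst].
    have E0 : E * 0 + 0 * M = 0 by rewrite mulr0 mul0r addr0.
    by rewrite E0 in H.
  apply: norm_cvg0; apply: (squeeze_cvgr _ (cvg_cst 0) bnd0).
  have eTnear : \forall e \near 0^'+, e < T by exact: nbhs_right_lt.
  near=> e; rewrite normr_ge0 /=.
  have e0 : 0 < e by near: e; exact: nbhs_right_gt.
  have eT : e < T by near: e.
  have dCe : d <= Ce e + a * SG T by near: e.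
  have HMe t : e <= t <= T -> `|W C t| <= M.
    by move=> /andP[et tT]; rewrite HM// tT (lt_le_trans e0).
  by have := comp e M e0 eT dCe M0 HMe; rewrite mulrDr !mulrA.
rewrite (_ : W C = fun e => laplace (u e) (chi C 0) +
    (W C e - laplace (u e) (chi C 0))); last first.
  by apply/funext => e; rewrite addrC subrK.
by rewrite -[expR _]addr0; apply: cvgD.
Unshelve. all: by end_near. Qed.

End InitialLimit.

(** * Uniqueness of the Laplace transform *)

Section Lerch.
Context {R : realType}.
Notation mu := (@lebesgue_measure R).

(** The moments of [exp(-x) h(x)] against the powers of [exp(-x)] are values of
    the Laplace transform at the positive integers. *)
Lemma laplace_orthogonal_polynomials (h : R -> R) :
  laplace_integrable h -> (forall s : R, 0 < s -> laplace h s = 0) ->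
  forall (p : {poly R}) (n : nat),
    mu.-integrable `]0, +oo[ (EFin \o (fun x =>
      expR (- (n.+1%:R * x)) * (p.[expR (- x)] * h x))) /\
    \int[mu]_(x in `]0, +oo[)
      (expR (- (n.+1%:R * x)) * (p.[expR (- x)] * h x)) = 0.
Proof.
move=> ih h0; elim/poly_ind => [|p k IH] n.
  have E x : expR (- (n.+1%:R * x)) * ((0 : {poly R}).[expR (- x)] * h x) = 0.
    by rewrite horner0 mul0r mulr0.
  split.
    by apply: eq_integrable (integrable0 _ _) => // x _; rewrite /= E.
  under eq_Rintegral do rewrite E.
  by rewrite Rintegral_cst// mul0r.
have [I1 I2] := IH n.+1.
have n0 : (0 : R) < n.+1%:R by rewrite ltr0n.
have ihn := ih _ n0.
have iZ : mu.-integrable `]0, +oo[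
    (fun x => k%:E * (EFin \o (fun x => expR (- (n.+1%:R * x)) * h x)%R) x)%E.
  exact: integrableZl ihn.
have E x : expR (- (n.+1%:R * x)) * ((p * 'X + k%:P).[expR (- x)] * h x) =
   expR (- (n.+2%:R * x)) * (p.[expR (- x)] * h x)
   + k * (expR (- (n.+1%:R * x)) * h x).
  rewrite hornerMXaddC (_ : - (n.+2%:R * x) = - (n.+1%:R * x) + - x).
    by rewrite expRD; ring.
  by rewrite -[n.+2]addn1 natrD; ring.
split.
  by apply: eq_integrable (integrableD _ I1 iZ) => // x _; rewrite /= E EFinD EFinM.
under eq_Rintegral do rewrite E.
rewrite RintegralD// I2 add0r RintegralZl//.
by rewrite -/(laplace h n.+1%:R) h0// mulr0.
Qed.

Lemma bernoulli_expn (z : R) (n : nat) : 0 <= z -> 1 + n%:R * z <= (1 + z) ^+ n.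
Proof.
move=> z0; elim: n => [|n IH]; first by rewrite mul0r addr0 expr0.
rewrite exprS -natr1; apply: le_trans (ler_wpM2l _ IH); last by rewrite addr_ge0.
have : 0 <= n%:R * z ^+ 2 by rewrite mulr_ge0 ?exprn_ge0.
by rewrite expr2; nra.
Qed.

(** If [h x0 > 0], test [exp(-x) h(x)] against the powers of the polynomial
    [Q = 1 + rho^2 - (y - y0)^2] in [y = exp(-x)], where [y0 = exp(- x0)].
    Near [x0], where [h] is positive, [Q] exceeds a number greater than 1, while
    [0 <= Q <= 1] wherever [h] may be negative: the integrals, which vanish,
    would tend to infinity. *)
Lemma laplace_zero_not_positive (h : R -> R) (x0 : R) :
  0 < x0 -> {for x0, continuous h} -> laplace_integrable h ->
  (forall s : R, 0 < s -> laplace h s = 0) -> h x0 <= 0.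
Proof.
move=> x00 ch ih lap0; rewrite leNgt; apply/negP => hx0.
pose h1 x := expR (- x) * h x.
have ih1 : mu.-integrable `]0, +oo[ (EFin \o h1).
  by apply: eq_integrable (ih 1 ltr01) => // x _; rewrite /= mul1r.
have ch1 : {for x0, continuous h1}.
  apply: cvgM; last exact: ch.
  have : is_derive x0 1 (fun x : R => expR (- x)) (- expR (- x0)).
    by derive_by; ring.
  exact: is_derive_continuous.
have h1x0 : 0 < h1 x0 by rewrite mulr_gt0// expR_gt0.
pose dl := h1 x0 / 2; have dl0 : 0 < dl by rewrite divr_gt0.
move/cvgrPdist_lt : ch1 => /(_ _ dl0) /nbhs_ballP[r1 /= r10 Hr1].
pose r := Num.min r1 x0.
have r0 : 0 < r by rewrite lt_min r10 x00.
have h1dl x : `|x0 - x| < r -> dl <= h1 x.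
  rewrite lt_min => /andP[xr _]; have := Hr1 _ xr.
  by move=> /ltW /(le_trans (ler_norm _)); rewrite /dl; lra.
pose y0 := expR (- x0).
(* rho is the distance of y from y0 outside the r-neighbourhood of x0 *)
pose rho := Num.min (expR (- (x0 - r)) - y0) (y0 - expR (- (x0 + r))).
have rho0 : 0 < rho.
  by rewrite lt_min !subr_gt0 !ltr_expR; apply/andP; split; lra.
have far x : r <= `|x0 - x| -> rho <= `|expR (- x) - y0|.
  case: (lerP x x0) => xx0 rx.
    rewrite (le_trans _ (ler_norm _))// ge_min lerD2r ler_expR.
    by apply/orP; left; lra.
  rewrite distrC (le_trans _ (ler_norm _))// ge_min lerD2l lerN2 ler_expR.
  by apply/orP; right; lra.
have near x : 0 < x -> `|expR (- x) - y0| <= `|x0 - x|.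
  move=> xpos; rewrite -[leRHS]mul1r [`|x0 - x|]distrC.
  apply: (derivative_bound_increment _ (fun z => expR (- z))) => z /andP[zl _].
  have z0 : 0 < z by apply: lt_le_trans zl; rewrite lt_min x00 xpos.
  have dz : is_derive z 1 (fun z : R => expR (- z)) (- expR (- z)).
    by derive_by; ring.
  split; first by case: dz.
  rewrite (is_derive1E dz) normrN ger0_norm ?expR_ge0// -expR0 ler_expR.
  by rewrite oppr_le0 ltW.
pose Q : {poly R} := (1 + rho ^+ 2)%:P - ('X - y0%:P) ^+ 2.
have QE y : Q.[y] = 1 + rho ^+ 2 - (y - y0) ^+ 2 by rewrite /Q !hornerE.
have B0 := integrable_norm ih1.
pose B := \int[mu]_(x in `]0, +oo[) `|h1 x|.
pose r' := Num.min (r / 2) (rho / 2).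
have r'0 : 0 < r' by rewrite lt_min !divr_gt0.
have r'r : r' < r by rewrite gt_min ltr_pdivrMr// ltr_pMr// ltr1n.
(* the negative part of the integral is at most B in absolute value *)
have inner n : (1 + rho ^+ 2 / 2) ^+ n * dl * (2 * r') <= B.
  pose g x := (Q ^+ n).[expR (- x)] * h1 x + `|h1 x|.
  have [I1 I2] := laplace_orthogonal_polynomials h ih lap0 (Q ^+ n) 0.
  have E x : expR (- (1%:R * x)) * ((Q ^+ n).[expR (- x)] * h x) =
      (Q ^+ n).[expR (- x)] * h1 x by rewrite mul1r /h1; ring.
  have iQ : mu.-integrable `]0, +oo[
      (EFin \o (fun x => (Q ^+ n).[expR (- x)] * h1 x)).
    by apply: eq_integrable I1 => // x _; rewrite /= E.
  have ig : mu.-integrable `]0, +oo[ (EFin \o g).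
    exact: integrableD iQ B0.
  have -> : B = \int[mu]_(x in `]0, +oo[) g x.
    rewrite /g RintegralD// -/B -[LHS]add0r -[X in X + _ = _]I2; congr (_ + _).
    by apply: eq_Rintegral => x _; rewrite E.
  have Q0 x : 0 < x -> 0 <= Q.[expR (- x)].
    move=> xpos; rewrite QE subr_ge0.
    have : `|expR (- x) - y0| <= 1.
      have e1 : expR (- x) <= 1 by rewrite -expR0 ler_expR oppr_le0 ltW.
      have e2 : y0 <= 1 by rewrite -expR0 ler_expR oppr_le0 ltW.
      have e3 := expR_ge0 (- x); have e4 : 0 <= y0 by exact: expR_ge0.
      by rewrite ler_norml; apply/andP; split; lra.
    move=> H; rewrite -[leLHS]real_normK ?num_real//.
    have := exprn_ile1 2 (normr_ge0 _) H; move/le_trans; apply.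
    by rewrite lerDl exprn_ge0// ltW.
  have g0 x : 0 < x -> 0 <= g x.
    move=> xpos; have Qx0 := Q0 x xpos; rewrite /g horner_exp.
    case: (lerP r (`|x0 - x|)) => [rx|xr].
      have Q1 : Q.[expR (- x)] <= 1.
        rewrite QE lerBlDr lerD2l -[leRHS]real_normK ?num_real//.
        by rewrite ler_pXn2r// ?nnegrE ?(ltW rho0)// far.
      have Qn1 : Q.[expR (- x)] ^+ n <= 1 by rewrite exprn_ile1.
      have Qn0 : 0 <= Q.[expR (- x)] ^+ n by rewrite exprn_ge0.
      have := ler_norm (- (Q.[expR (- x)] ^+ n * h1 x)).
      rewrite normrN normrM (ger0_norm Qn0).
      by have : Q.[expR (- x)] ^+ n * `|h1 x| <= `|h1 x| by [rewrite ler_piMl]; lra.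
    rewrite addr_ge0// mulr_ge0 ?exprn_ge0//.
    by rewrite (le_trans (ltW dl0))// h1dl.
  pose I' := `[x0 - r', x0 + r']%classic.
  have rx0 : r <= x0 by rewrite ge_min lexx orbT.
  have subI : I' `<=` (`]0, +oo[ : set R).
    by apply: subset_itv; rewrite bnd_simp//; lra.
  have gI x : x0 - r' <= x <= x0 + r' -> (1 + rho ^+ 2 / 2) ^+ n * dl <= g x.
    move=> xI; have xr' : `|x0 - x| <= r' by rewrite ler_distlC.
    have xpos : 0 < x by case/andP: xI; lra.
    have xr : `|x0 - x| < r by exact: le_lt_trans r'r.
    rewrite /g horner_exp -[leLHS]addr0 lerD// ler_pM//.
    - by rewrite exprn_ge0// addr_ge0// divr_ge0 ?exprn_ge0// ltW.
    - exact: ltW.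
    - have z0 : 0 <= rho ^+ 2 / 2 by rewrite divr_ge0// exprn_ge0// ltW.
      have yr : `|expR (- x) - y0| <= rho / 2.
        apply: le_trans (near x xpos) _; apply: le_trans xr' _.
        by rewrite ge_min lexx orbT.
      have sq : (expR (- x) - y0) ^+ 2 <= (rho / 2) ^+ 2.
        rewrite -[leLHS]real_normK ?num_real// lerXn2r ?nnegrE//.
        by rewrite divr_ge0// ltW.
      have sr : 0 <= rho ^+ 2 by rewrite exprn_ge0// ltW.
      rewrite expr_div_n in sq.
      by rewrite lerXn2r ?nnegrE ?addr_ge0 ?Q0// QE; lra.
    - exact: h1dl.
  have igI : mu.-integrable I' (EFin \o g).
    by apply: integrableS ig => //; exact: measurable_itv.
  have mI : (mu I' = (2 * r')%:E)%E.
    rewrite lebesgue_measure_itv /= lte_fin ifT; last by lra.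
    by rewrite -EFinD; congr EFin; ring.
  apply: (@le_trans _ _ (\int[mu]_(x in I') g x)).
    rewrite -[X in _ * X](_ : fine (mu I') = 2 * r'); last by rewrite mI.
    rewrite -Rintegral_cst; last exact: measurable_itv.
    apply: le_Rintegral => //; first exact: measurable_itv.
    apply: continuous_compact_integrable; first exact: segment_compact.
    by apply: continuous_subspaceT => z; exact: cvg_cst.
  rewrite /Rintegral fine_le//.
  - by apply: integrable_fin_num => //; exact: measurable_itv.
  - exact: integrable_fin_num.
  - apply: ge0_subset_integral => //; [exact: measurable_itv|exact: measurable_int ig|].
    by move=> x; rewrite /= in_itv /= andbT => /g0; rewrite lee_fin.
have [z z0 zE] : exists2 z, 0 < z & rho ^+ 2 / 2 = z.
  by exists (rho ^+ 2 / 2); rewrite // divr_gt0// exprn_gt0.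
rewrite zE in inner.
have r'2 : 0 < 2 * r' by rewrite mulr_gt0.
have zdl := mulr_gt0 (mulr_gt0 z0 dl0) r'2.
pose n := (Num.truncn (B / (z * dl * (2 * r')))).+1.
have : B < n%:R * (z * dl * (2 * r')) by rewrite -ltr_pdivrMr// truncnS_gt.
apply/negP; rewrite -leNgt; apply: le_trans (inner n).
rewrite (mulrA n%:R (z * dl)) (mulrA n%:R z) ler_wpM2r ?(ltW r'2)// ler_wpM2r ?(ltW dl0)//.
apply: le_trans (bernoulli_expn z n (ltW z0)).
by rewrite lerDr.
Qed.

Lemma laplace_injective (h : R -> R) :
  (forall x : R, 0 < x -> {for x, continuous h}) -> laplace_integrable h ->
  (forall s : R, 0 < s -> laplace h s = 0) -> forall x : R, 0 < x -> h x = 0.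
Proof.
move=> ch ih lap0 x x0; apply/le_anti; apply/andP; split.
  exact: laplace_zero_not_positive (ch x x0) ih lap0.
rewrite -oppr_le0; apply: (laplace_zero_not_positive (fun x => - h x) x x0).
- by apply: cvgN; exact: ch.
- by move=> s s0; apply: eq_integrable (laplace_integrableZ _ (-1) _ ih s s0) => // z _;
    rewrite /= mulN1r.
- move=> s s0; have ihs := ih s s0.
  transitivity (-1 * laplace h s); last by rewrite lap0// mulr0.
  by rewrite /laplace -RintegralZl//; apply: eq_Rintegral => z _; ring.
Qed.

End Lerch.

(** * The fundamental solution *)

Theorem mainTheorem2 (R : realType) (a b c v xi : R)
    (a_gt0 : 0 < a) (v_gt0 : 0 < v) (xi_gt0 : 0 < xi)
    (u : R -> R -> R) (f : R -> R)
    (u_fund : is_fundamental_solution a b c v xi u)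
    (f_flux : is_flux a b c v u f) :
  (exists G : R -> R -> R, is_indefinite_integral a b c v G) /\
  forall G : R -> R -> R, is_indefinite_integral a b c v G ->
  forall t : R, 0 < t ->
    (forall s : R, 0 < s ->
       cvg (truncated_integral
              (fun tau => f tau * expR (G tau (K a b v t s))) t e
            @[e --> 0^'+]) /\
       laplace (u t) s = omega a b v xi G f t s) /\
    is_inverse_laplace (omega a b v xi G f t) (u t).
Proof.
split; first exact: indefinite_integral_exists.
move=> G G_int t t0; have [u_sol _ u_init] := u_fund.
have repr (s : R) : 0 < s ->
    cvg (truncated_integral
           (fun tau => f tau * expR (G tau (K a b v t s))) t e @[e --> 0^'+]) /\
    laplace (u t) s = omega a b v xi G f t s.
  move=> s0; set C := K a b v t s.
  have denC : G_denominator a b v C t = s^-1 by exact: G_denominator_K.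
  have denC0 : 0 < G_denominator a b v C t by rewrite denC invr_gt0.
  have chit : characteristic a b v C t = s by rewrite /characteristic denC invrK.
  have WtE : transform_along a b v u C t = laplace (u t) s.
    by rewrite /transform_along chit.
  pose W tau := transform_along a b v u C tau.
  have D0 : 0 < C + a * scaled_Gamma b v 0.
    have := G_denominator_gt0 a b v a_gt0 v_gt0 C 0 t (lexx 0) (ltW t0) denC0.
    by rewrite G_denominatorE mulr0 expR0 mul1r.
  have Winit := transform_along_initial a b c v xi u f G a_gt0 v_gt0 u_sol f_flux G_int C D0 u_init.
  (* along the characteristic through (t, s) the weight exp(G) leaves the flux only *)
  have truncE e : 0 < e -> e < t ->
      truncated_integral (fun tau => f tau * expR (G tau C)) t e =
      expR (G t C) * laplace (u t) s - expR (G e C) * W e.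
    move=> e0 et.
    have [_] := weighted_identity a b c v u f G
      a_gt0 v_gt0 u_sol f_flux G_int C C e t e0 et denC0 denC0.
    rewrite WtE => <-.
    apply: eq_Rintegral => z _.
    by rewrite subrr mulr0 !mul0r addr0 mulrC.
  have lim : truncated_integral (fun tau => f tau * expR (G tau C)) t e @[e --> 0^'+] -->
      expR (G t C) * laplace (u t) s
      - expR (G 0 C) * expR (- (characteristic a b v C 0 * xi)).
    have : expR (G t C) * laplace (u t) s - expR (G e C) * W e @[e --> 0^'+] -->
        expR (G t C) * laplace (u t) s
        - expR (G 0 C) * expR (- (characteristic a b v C 0 * xi)).
      apply: cvgB; first exact: cvg_cst.
      apply: cvgM; last exact: Winit.
      have den0 r : 0 <= r <= t -> G_denominator a b v C r != 0.
        by move=> /andP[r0 rt]; rewrite gt_eqF//; exact: G_denominator_gt0 denC0.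
      have [cG _] := G_int C t t0 den0.
      have [_ G0 _] := (continuous_within_itvP _ t0).1 cG.
      apply: (cvg_comp _ _ G0); exact: continuous_expR.
    apply: cvg_trans; apply: near_eq_cvg; near=> e; apply/esym/truncE.
      by near: e; exact: nbhs_right_gt.
    by near: e; exact: nbhs_right_lt.
  split; first by apply/cvg_ex; eexists; exact: lim.
  have chi0 : characteristic a b v C 0 * xi = s * expR (b * t) * xi /
      (1 - s * expR (b * t) * a * (scaled_Gamma b v t - scaled_Gamma b v 0)).
    rewrite characteristicE mulr0 oppr0 expR0.
    have e0 := expR_gt0 (b * t).
    have D0E : 1 - s * expR (b * t) * a * (scaled_Gamma b v t - scaled_Gamma b v 0)
        = s * expR (b * t) * (C + a * scaled_Gamma b v 0).
      by rewrite /C /K; field; rewrite !gt_eqF.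
    by rewrite D0E; field; rewrite !gt_eqF.
  rewrite /omega /improper_integral (cvg_lim _ lim)// -/C -chi0.
  rewrite mulrBr !mulrA -!expRD addNr expR0 mul1r.
  by rewrite [RHS]addrC subrK.
have [du _ _ [iu _] _] := u_sol.
have cu (x : R) : 0 < x -> {for x, continuous (u t)}.
  move=> x0; have [_ dx _] := du t x t0 x0.
  exact: is_derive_continuous (derivableP dx).
split; first exact: repr.
split.
  by split; [exact: cu|exact: iu|move=> s s0; have [] := repr s s0].
move=> k [ck ik kE] x x0; apply/eqP; rewrite -subr_eq0; apply/eqP.
have iN : laplace_integrable (fun z => -1 * u t z).
  by apply: laplace_integrableZ; exact: iu.
have -> : k x - u t x = k x + -1 * u t x by rewrite mulN1r.
apply: (laplace_injective (fun z => k z + -1 * u t z)) => //.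
- by move=> z z0; apply: cvgD; [exact: ck|apply: cvgM; [exact: cvg_cst|exact: cu]].
- exact: laplace_integrableD.
- move=> s s0; have iks := ik s s0; have ius := iu t t0 s s0; have iNs := iN s s0.
  transitivity (laplace k s + -1 * laplace (u t) s).
    rewrite /laplace -RintegralZl//.
    have -> : \int[@lebesgue_measure R]_(x in `]0, +oo[) (-1 * (expR (- (s * x)) * u t x)) =
        \int[@lebesgue_measure R]_(x in `]0, +oo[) (expR (- (s * x)) * (-1 * u t x)).
      by apply: eq_Rintegral => z _; rewrite mulrCA.
    rewrite -RintegralD//; apply: eq_Rintegral => z _.
    by rewrite mulrDr.
  by rewrite kE// (repr s s0).2 mulN1r subrr.
Unshelve. all: by end_near. Qed.
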